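(* Assume hypotheses (H) and (G). Then for all $r\ge3$, $$T_r(x)=\mathbb O(x)\,T_{r-1}(x)-\mathbb S(x)\,T_{r-2}(x)+\mathbb O(x)^{r-2}\,\mathbb S(x).$$
   Context: For integers $N,r\ge1$ let $S_{N,r}=\{(n_1,\dots,n_r)\in\mathbb Z^r:\ n_1+\dots+n_r=N,\ \text{each } n_i\ge3 \text{ odd}\}$; when used as an index set it is ordered lexicographically decreasingly. For $m=(m_1,\dots,m_r)$ and $n=(n_1,\dots,n_r)$ let $\delta\binom{m}{n}=1$ if $m_i=n_i$ for all $i$, and $0$ otherwise. $\mathbf V_{N,r}$ is the $\mathbb Q$-span of the monomials $x_1^{n_1-1}\cdots x_r^{n_r-1}$ with $(n_1,\dots,n_r)\in S_{N,r}$. $\mathsf{Vect}_{N,r}=\mathbb Q^{S_{N,r}}$ (row vectors), and $\pi:\mathbf V_{N,r}\to\mathsf{Vect}_{N,r}$ is the isomorphism sending $\sum a_{n_1,\dots,n_r}x_1^{n_1-1}\cdots x_r^{n_r-1}$ to $(a_{n_1,\dots,n_r})_{(n_1,\dots,n_r)\in S_{N,r}}$. For $r\ge2$, $\mathbf W_{N,r}=\{P\in\mathbf V_{N,r}: P(x_1,\dots,x_r)=P(x_2-x_1,x_2,x_3,\dots,x_r)-P(x_2-x_1,x_1,x_3,\dots,x_r)\}$. Ihara action: for $f\in\mathbb Q[t]$ and a polynomial $g$ in $r-1$ variables, $(f\mathbin{\underline\circ}g)(x_1,\dots,x_r)=f(x_1)g(x_2,\dots,x_r)+\sum_{i=1}^{r-1}\big(f(x_{i+1}-x_i)g(x_1,\dots,\widehat{x_{i+1}},\dots,x_r)-(-1)^{\deg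 f}f(x_i-x_{i+1})g(x_1,\dots,\widehat{x_i},\dots,x_r)\big)$ (hats denote omitted variables). For positive integers $m_i,n_i$, $e\binom{m_1,\dots,m_r}{n_1,\dots,n_r}$ is the coefficient of $x_1^{n_1-1}\cdots x_r^{n_r-1}$ in $t^{m_1-1}\mathbin{\underline\circ}\,(y_1^{m_2-1}\cdots y_{r-1}^{m_r-1})$. $E_{N,r}$ is the $S_{N,r}\times S_{N,r}$ matrix with $(m,n)$-entry $e\binom{m}{n}$. For $2\le j\le r$, $E^{(j)}_{N,r}$ is the $S_{N,r}\times S_{N,r}$ matrix with $(m,n)$-entry $\delta\binom{m_1,\dots,m_{r-j}}{n_1,\dots,n_{r-j}}\,e\binom{m_{r-j+1},\dots,m_r}{n_{r-j+1},\dots,n_r}$ (so $E^{(r)}_{N,r}=E_{N,r}$). $C_{N,r}=E^{(2)}_{N,r}E^{(3)}_{N,r}\cdots E^{(r-1)}_{N,r}E_{N,r}$ (so $C_{N,2}=E_{N,2}$), and $F_{N,r}=E_{N,r}-\mathrm{id}$. For a matrix $A$, $\ker A$ denotes its right kernel. The restricted totally even part of a polynomial is the sum of its monomials in which every variable $x_1,\dots,x_r$ occurs with even exponent $\ge2$. For $1\le j\le r$, $\phi^{(j)}_{N,r}:\mathbf V_{N,r}\to\mathbf V_{N,r}$ is the linear map sending $Q$ to the restricted totally even part of $Q(x_1,\dots,x_r)+\sum_{i=r-j+1}^{r-1}\big(Q(x_1,\dots,x_{r-j},x_{i+1}-x_i,x_{r-j+1},\dots,\widehat{x_{i+1}},\dots,x_r)-Q(x_1,\dots,x_{r-j},x_{i+1}-x_i,x_{r-j+1},\dots,\widehat{x_i},\dots,x_r)\big)$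 (in each term the argument list after $x_{i+1}-x_i$ is $x_{r-j+1},\dots,x_r$ with one variable omitted). $\mathbb O(x)=\frac{x^3}{1-x^2}$, $\mathbb S(x)=\frac{x^{12}}{(1-x^4)(1-x^6)}$. For $r\ge2$, $T_r(x)=\sum_{N>0}\dim_{\mathbb Q}\ker C_{N,r}\,x^N$, and $T_0(x)=T_1(x)=0$. It is known (Tasaka) that for $r\ge2$ and $P\in\mathbf W_{N,r}$, $\pi(P)F_{N,r}$ lies in the left kernel $\{v: vE_{N,r}=0\}$; and it is known (Baumard–Schneps) that $\pi(\mathbf W_{N,2})=\{v: vE_{N,2}=0\}$, with $\sum_N\dim\mathbf W_{N,2}x^N=\mathbb S(x)$. Hypothesis (H): for all $N$ and all $r\ge2$ the linear map $\mathbf W_{N,r}\to\{v\in\mathsf{Vect}_{N,r}: vE_{N,r}=0\}$, $P\mapsto\pi(P)F_{N,r}$, is injective. Hypothesis (G): for all $r\ge3$ and all $N$, $\big(\phi^{(r-1)}_{N,r}\circ\cdots\circ\phi^{(2)}_{N,r}\big)(\mathbf W_{N,r})=\ker\phi^{(r)}_{N,r}\cap\big(\phi^{(r-1)}_{N,r}\circ\cdots\circ\phi^{(2)}_{N,r}\big)(\mathbf V_{N,r})$. *)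

(* Defs.v *)
From HB Require Import structures.
From mathcomp Require Import all_boot all_order all_algebra.
Set Implicit Arguments. Unset Strict Implicit. Unset Printing Implicit Defensive.
Import Order.TTheory GRing.Theory Num.Theory.
Local Open Scope ring_scope.

(* A polynomial in r variables is a finite list of terms (exponent vector of
   length r, coefficient).  Two lists represent the same polynomial iff all
   their coefficient functions [mcoef] agree. *)
Definition mpoly := seq (seq nat * rat).

Definition mcoef (p : mpoly) (e : seq nat) : rat :=
  \sum_(t <- p | t.1 == e) t.2.

Definition meq (p q : mpoly) : Prop := forall e, mcoef p e = mcoef q e.

Definition madd (p q : mpoly) : mpoly := p ++ q.
Definition mscale (c : rat) (p : mpoly) : mpoly := [seq (t.1, c * t.2) | t <- p].
Definition msub (p q : mpoly) : mpoly := madd p (mscale (-1) q).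
Definition addexp (e f : seq nat) : seq nat :=
  [seq (nth 0 e i + nth 0 f i)%N | i <- iota 0 (maxn (size e) (size f))].
Definition mmul (p q : mpoly) : mpoly :=
  [seq (addexp t.1 u.1, t.2 * u.2) | t <- p, u <- q].
(* constant 1 and the variable x_{i+1} (0-based index i) in r variables *)
Definition mone (r : nat) : mpoly := [:: (nseq r 0%N, 1)].
Definition mvar (r i : nat) : mpoly := [:: (mkseq (fun k => nat_of_bool (k == i)) r, 1)].
Definition mpow (r : nat) (p : mpoly) (k : nat) : mpoly := iter k (mmul p) (mone r).
Definition msubst (r : nat) (p : mpoly) (qs : seq mpoly) : mpoly :=
  flatten [seq mscale t.2
             (foldr mmul (mone r) [seq mpow r qk.1 qk.2 | qk <- zip qs t.1])
          | t <- p].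

Fixpoint Sseq (N r : nat) : seq (seq nat) :=
  match r with
  | 0 => if N == 0%N then [:: [::]] else [::]
  | r'.+1 => flatten [seq [seq n :: s | s <- Sseq (N - n) r']
                     | n <- rev (iota 0 N.+1) & odd n && (3 <= n)%N]
  end.

Definition kS (N r : nat) : nat := size (Sseq N r).
Definition Sidx (N r : nat) (i : 'I_(kS N r)) : seq nat := nth [::] (Sseq N r) i.

(* pi^{-1}: the polynomial sum_n a_n x_1^{n_1-1}...x_r^{n_r-1} of V_{N,r} *)
Definition polyV (N r : nat) (v : 'rV[rat]_(kS N r)) : mpoly :=
  [seq (map predn (Sidx i), v ord0 i) | i : 'I_(kS N r)].

Definition inW (N r : nat) (v : 'rV[rat]_(kS N r)) : Prop :=
  let P := polyV v in
  let x := mvar r in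
  let rest := [seq x k | k <- iota 2 (r - 2)] in
  meq P (msub (msubst r P [:: msub (x 1%N) (x 0%N), x 1%N & rest])
              (msubst r P [:: msub (x 1%N) (x 0%N), x 0%N & rest])).

(* (f o g)(x_1..x_j) with f a polynomial in 1 variable of degree degf and
   g a polynomial in j-1 variables *)
Definition ihara (j : nat) (f : mpoly) (degf : nat) (g : mpoly) : mpoly :=
  let x := mvar j in
  madd (mmul (msubst j f [:: x 0%N]) (msubst j g [seq x k | k <- iota 1 (j - 1)]))
   (flatten [seq msub
      (mmul (msubst j f [:: msub (x i.+1) (x i)])
            (msubst j g [seq x k | k <- iota 0 j & k != i.+1]))
      (mscale ((-1) ^+ degf)
        (mmul (msubst j f [:: msub (x i) (x i.+1)])
              (msubst j g [seq x k | k <- iota 0 j & k != i])))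
    | i <- iota 0 (j - 1)]).

Definition ecoef (m n : seq nat) : rat :=
  let j := size m in
  let a := (head 0%N m).-1 in
  mcoef (ihara j [:: ([:: a], 1)] a [:: (map predn (behead m), 1)]) (map predn n).

Definition Emx (N r : nat) : 'M[rat]_(kS N r) :=
  \matrix_(i, k) ecoef (Sidx i) (Sidx k).

Definition Ejmx (N r j : nat) : 'M[rat]_(kS N r) :=
  \matrix_(i, k) ((take (r - j) (Sidx i) == take (r - j) (Sidx k))%:R
                  * ecoef (drop (r - j) (Sidx i)) (drop (r - j) (Sidx k))).

Definition Cmx (N r : nat) : 'M[rat]_(kS N r) :=
  foldr (fun j M => Ejmx N r j *m M) 1%:M (iota 2 (r - 1)).

Definition Fmx (N r : nat) : 'M[rat]_(kS N r) := Emx N r - 1%:M.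

Definition phi (N r j : nat) (v : 'rV[rat]_(kS N r)) : 'rV[rat]_(kS N r) :=
  let Q := polyV v in
  let x := mvar r in
  let args (i omit : nat) :=
    [seq x k | k <- iota 0 (r - j)] ++ [:: msub (x i.+1) (x i)]
      ++ [seq x k | k <- iota (r - j) j & k != omit] in
  let expr := madd Q (flatten [seq msub (msubst r Q (args i i.+1)) (msubst r Q (args i i))
                              | i <- iota (r - j) (j - 1)]) in
  (* restricted totally even part, read off through pi *)
  \row_(i < kS N r) mcoef expr (map predn (Sidx i)).

Definition phicomp (N r : nat) (v : 'rV[rat]_(kS N r)) : 'rV[rat]_(kS N r) :=
  foldl (fun w j => phi j w) v (iota 2 (r - 2)).

Definition hypH : Prop :=
  forall N r, (2 <= r)%N -> forall v w : 'rV[rat]_(kS N r),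
    inW v -> inW w -> v *m Fmx N r = w *m Fmx N r -> v = w.

Definition hypG : Prop :=
  forall r N, (3 <= r)%N -> forall u : 'rV[rat]_(kS N r),
    (exists2 v, inW v & phicomp v = u) <->
    (phi r u = 0 /\ exists v, phicomp v = u).

Definition series := nat -> rat.
Definition mulS (f g : series) : series := fun n => \sum_(i < n.+1) f i * g (n - i)%N.
Definition serX (k : nat) : series := fun n => (n == k)%:R.
(* 1/(1 - x^d) *)
Definition geomS (d : nat) : series := fun n => (d %| n)%N%:R.
Definition powS (f : series) (k : nat) : series := iter k (mulS f) (serX 0).
Definition addS (f g : series) : series := fun n => f n + g n.
Definition subS (f g : series) : series := fun n => f n - g n.

Definition OS : series := mulS (serX 3) (geomS 2).
Definition SS : series := mulS (serX 12) (mulS (geomS 4) (geomS 6)).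

(* T_r(x) = sum_{N>0} dim ker C_{N,r} x^N (right kernel), T_0 = T_1 = 0 *)
Definition Tser (r : nat) : series := fun N =>
  if (r < 2)%N || (N == 0%N) then 0
  else (\rank (kermx (Cmx N r)^T))%:R.

(* Main.v *)
(* Identify a row vector with its polynomial. Right multiplication by E^(j) is
   then phi^(j), so with B = E^(2) ... E^(r-1) and C_r = B E_r we get
     dim ker C_r = dim ker B + dim (im B /\ ker E_r),
   where ker denotes left kernels. Splitting off the first index makes B block
   diagonal with blocks C_{N-n,r-1}, which gives the term O T_{r-1}; and (G) says
   im B /\ ker E_r = W_r B.

   For P in W_r the defining equation and the antisymmetry in (x_1, x_2) give
   P F_r = - P E^(r-1), so (H) makes E^(r-1) injective on W_r. Moreover W_r is the
   sum over n of W_{n,2} (x) Vect_{N-n,r-2}, and E^(2) ... E^(r-2) acts on the second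
   factor as C_{N-n,r-2}. Hence
     dim W_r B = sum_n dim W_{n,2} rank C_{N-n,r-2},
   which gives the other two terms once dim W_{n,2} is the n-th coefficient of S.

   For that, put w = n - 2 and let U be the substitution (x, y) -> (y, - x - y) of
   order 3. W_{n,2} is the kernel of 1 + U + U^2 on even skew-symmetric forms with
   both exponents in [2, w - 2]. The image lies in the space of U-invariant
   skew-symmetric forms, of dimension w %/ 6. By the GL_2-invariant pairing, the
   image is all of it as soon as no nonzero such form is odd in x; but such a form is
   invariant under (x, y) -> (x + y, y), hence a multiple of y^w, hence 0. *)
Require Import Defs.
From mathcomp Require Import all_boot all_order all_algebra.
From mathcomp Require Import zify ring lra.
Set Implicit Arguments. Unset Strict Implicit. Unset Printing Implicit Defensive.
Import Order.TTheory GRing.Theory Num.Theory.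
Local Open Scope ring_scope.

(** * Evaluation of polynomials *)

Definition monom (z : seq rat) (e : seq nat) : rat :=
  \prod_(k < size z) z`_k ^+ nth 0%N e k.

(** Values at rational points turn identities between substituted term lists into ring identities;
    [mcoef_eq] brings the result back to coefficients. *)
Definition meval (z : seq rat) (p : mpoly) : rat :=
  \sum_(t <- p) t.2 * monom z t.1.

(** The exponents [[::]] and [[:: 0]] give the same values but are distinct for [mcoef], so passing
    from values to coefficients requires a fixed length. *)
Definition homsize (r : nat) (p : mpoly) : bool := all (fun t => size t.1 == r) p.

Lemma monom_nil e : monom [::] e = 1.
Proof. by rewrite /monom big_ord0. Qed.

Lemma monom_cons x z a e : monom (x :: z) (a :: e) = x ^+ a * monom z e.
Proof. by rewrite /monom big_ord_recl. Qed.

Lemma monom_cat z1 z2 e1 e2 : size z1 = size e1 ->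
  monom (z1 ++ z2) (e1 ++ e2) = monom z1 e1 * monom z2 e2.
Proof.
elim: z1 e1 => [|x z1 IH] [|a e1] //= => [_|[sz]]; first by rewrite monom_nil mul1r.
by rewrite !monom_cons IH // mulrA.
Qed.

Lemma monom_nseq0 z n : monom z (nseq n 0%N) = 1.
Proof. by rewrite /monom big1 // => k _; rewrite nth_nseq if_same expr0. Qed.

Lemma monom_e0 z : monom z [::] = 1.
Proof. exact: (monom_nseq0 z 0). Qed.

Lemma monom_addexp z e f : monom z (addexp e f) = monom z e * monom z f.
Proof.
rewrite /monom -big_split; apply: eq_bigr => k _ /=; rewrite -exprD; congr (_ ^+ _).
rewrite /addexp; case: (ltnP k (maxn (size e) (size f))) => h.
  by rewrite (nth_map 0%N) ?size_iota // nth_iota.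
rewrite nth_default ?size_map ?size_iota //.
by move: h; rewrite geq_max => /andP[h1 h2]; rewrite !nth_default.
Qed.

Lemma meval_cat z p q : meval z (p ++ q) = meval z p + meval z q.
Proof. by rewrite /meval big_cat. Qed.

Lemma meval_scale z c p : meval z (mscale c p) = c * meval z p.
Proof. by rewrite /meval big_map mulr_sumr; apply: eq_bigr => t _; rewrite mulrA. Qed.

Lemma meval_sub z p q : meval z (msub p q) = meval z p - meval z q.
Proof. by rewrite /msub meval_cat meval_scale mulN1r. Qed.

Lemma meval_mul z p q : meval z (mmul p q) = meval z p * meval z q.
Proof.
rewrite /meval /mmul big_allpairs_dep /= mulr_suml; apply: eq_bigr => t _.
by rewrite mulr_sumr; apply: eq_bigr => u _; rewrite monom_addexp; ring.
Qed.

Lemma meval_one z r : meval z (mone r) = 1.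
Proof. by rewrite /meval big_seq1 monom_nseq0 mulr1. Qed.

Lemma meval_pow z r p k : meval z (mpow r p k) = meval z p ^+ k.
Proof.
by elim: k => [|k IH]; rewrite ?meval_one //= meval_mul IH exprS.
Qed.

Lemma meval_var z r i : size z = r -> (i < r)%N -> meval z (mvar r i) = z`_i.
Proof.
move=> sz ir; rewrite /meval big_seq1 mul1r /monom.
have iz : (i < size z)%N by rewrite sz.
rewrite (bigD1 (Ordinal iz)) //= nth_mkseq // eqxx expr1 big1 ?mulr1 // => k ki.
rewrite nth_mkseq; last by rewrite -sz.
suff -> : (k == i :> nat) = false by rewrite expr0.
by apply/eqP => e; case/eqP: ki; apply/val_inj.
Qed.

Lemma meval_subst z r p qs :
  meval z (msubst r p qs) = meval [seq meval z q | q <- qs] p.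
Proof.
rewrite /meval /msubst big_flatten big_map; apply: eq_bigr => t _.
rewrite -/(meval _ _) meval_scale; congr (_ * _).
elim: qs t.1 => [|q qs IH] [|a e] /=; rewrite ?meval_one ?monom_nil ?monom_e0 //.
by rewrite meval_mul meval_pow IH monom_cons.
Qed.

Lemma meval_flatten z (I : Type) (s : seq I) (F : I -> mpoly) :
  meval z (flatten [seq F i | i <- s]) = \sum_(i <- s) meval z (F i).
Proof. by rewrite /meval big_flatten big_map. Qed.

Lemma homsizeP r p t : homsize r p -> t \in p -> size t.1 = r.
Proof. by move=> /allP h /h /eqP. Qed.

Lemma homsize_cat r p q : homsize r (p ++ q) = homsize r p && homsize r q.
Proof. exact: all_cat. Qed.

Lemma homsize_scale r c p : homsize r (mscale c p) = homsize r p.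
Proof. by rewrite /homsize all_map. Qed.

Lemma homsize_sub r p q : homsize r p -> homsize r q -> homsize r (msub p q).
Proof. by move=> hp hq; rewrite /msub homsize_cat homsize_scale hp. Qed.

Lemma homsize_mul r p q : homsize r p -> homsize r q -> homsize r (mmul p q).
Proof.
move=> /allP hp /allP hq; apply/allP => _ /allpairsP[[t u] /= [tp uq ->]] /=.
have /= /eqP st := hp _ tp; have /= /eqP su := hq _ uq.
by rewrite size_map size_iota st su maxnn.
Qed.

Lemma homsize_one r : homsize r (mone r).
Proof. by rewrite /homsize /= size_nseq eqxx. Qed.

Lemma homsize_var r i : homsize r (mvar r i).
Proof. by rewrite /homsize /= size_mkseq eqxx. Qed.

Lemma homsize_flatten r (I : eqType) (s : seq I) (F : I -> mpoly) :
  (forall i, i \in s -> homsize r (F i)) -> homsize r (flatten [seq F i | i <- s]).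
Proof.
elim: s => //= i s IH h; rewrite homsize_cat h ?mem_head //=.
by apply: IH => k ks; rewrite h // inE ks orbT.
Qed.

Lemma homsize_subst r p qs : all (homsize r) qs -> homsize r (msubst r p qs).
Proof.
move=> hq; rewrite /msubst; apply: homsize_flatten => t _; rewrite homsize_scale.
elim: qs t.1 hq => [|q qs IH] [|a e] /= hq; try exact: homsize_one.
case/andP: hq => h1 h2; apply: homsize_mul; last exact: IH.
by elim: a => [|a IHa]; [apply: homsize_one | apply: homsize_mul].
Qed.

Lemma mcoef_cat p q e : mcoef (p ++ q) e = mcoef p e + mcoef q e.
Proof. by rewrite /mcoef big_cat. Qed.

Lemma mcoef_scale c p e : mcoef (mscale c p) e = c * mcoef p e.
Proof. by rewrite /mcoef big_map mulr_sumr. Qed.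

(** Otherwise there would be more roots than the degree allows. Testing at positive integers only
    keeps later test points away from [y = 0]. *)
Lemma poly_nat_eq0 (p : {poly rat}) : (forall n : nat, p.[n.+1%:R] = 0) -> p = 0.
Proof.
move=> h; apply/eqP; apply/negPn/negP => p0.
have := max_poly_roots p0 (rs := [seq n.+1%:R | n <- iota 0 (size p)]).
rewrite size_map size_iota ltnn => H; suff : false by [].
apply: H; first by apply/allP => x /mapP[n _ ->]; rewrite /root h.
rewrite map_inj_uniq ?iota_uniq // => a b /eqP; rewrite eqr_nat => /eqP; lia.
Qed.

(** Induction on the number of variables: with the other variables fixed, the polynomial in the
    first one has infinitely many roots, so each of its coefficients vanishes. *)
Lemma mcoef_vanish r p : homsize r p ->
  (forall z, size z = r -> meval z p = 0) -> forall e, mcoef p e = 0.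
Proof.
elim: r p => [|r IH] p hp hz e.
  case: e => [|a e].
    rewrite /mcoef -[RHS](hz [::] erefl) /meval big_seq_cond [RHS]big_seq_cond.
    apply: eq_big => t; last by rewrite monom_nil mulr1.
    by case tp: (t \in p); rewrite //= (size0nil (homsizeP hp tp)).
  by rewrite /mcoef big_seq_cond big1 // => t /andP[/(homsizeP hp)/size0nil ->].
case: e => [|a e].
  rewrite /mcoef big_seq_cond big1 // => t /andP[/(homsizeP hp) h /eqP E].
  by rewrite E in h.
(* [q] is the coefficient of the [a]-th power of the first variable, a polynomial in the remaining
   ones. *)
pose q := [seq (behead t.1, t.2) | t <- p & head 0%N t.1 == a].
have hq : homsize r q.
  rewrite /homsize all_map; apply/allP => t; rewrite mem_filter => /andP[_ /(homsizeP hp) ht] /=.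
  by rewrite size_behead ht.
rewrite (_ : mcoef p (a :: e) = mcoef q e).
  apply: IH => // z sz.
  pose Q := \sum_(t <- p) (t.2 * monom z (behead t.1)) *: 'X^(head 0%N t.1).
  have Q0 : Q = 0.
    apply: poly_nat_eq0 => n; rewrite -[RHS](hz (n.+1%:R :: z)) /= ?sz // /Q /meval horner_sum.
    rewrite big_seq [RHS]big_seq; apply: eq_bigr => t /(homsizeP hp).
    by rewrite !hornerE; case: (t.1) => //= b f _; rewrite monom_cons; ring.
  have: Q`_a = 0 by rewrite Q0 coef0.
  rewrite /Q coef_sum => <-; rewrite /meval big_map big_filter big_mkcond /=.
  apply: eq_bigr => t _; rewrite coefZ coefXn eq_sym.
  by case: (a == _); rewrite ?mulr1 ?mulr0.
rewrite /mcoef big_map big_filter_cond /=.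
rewrite big_seq_cond [RHS]big_seq_cond; apply: eq_bigl => t.
case tp: (t \in p) => //=; move: (homsizeP hp tp).
by case: (t.1).
Qed.

Lemma mcoef_eq r p q : homsize r p -> homsize r q ->
  (forall z, size z = r -> meval z p = meval z q) -> meq p q.
Proof.
move=> hp hq h e; apply/eqP; rewrite -subr_eq0 -mulN1r -mcoef_scale -mcoef_cat; apply/eqP.
apply: (@mcoef_vanish r); first exact: homsize_sub.
by move=> z sz; rewrite -/(msub p q) meval_sub h // subrr.
Qed.

(** Both lists are regrouped along one duplicate-free list containing all their exponents. *)
Lemma meq_meval p q : meq p q -> forall z, meval z p = meval z q.
Proof.
move=> h z.
have ev (s : mpoly) (us : seq (seq nat)) : uniq us -> {subset [seq t.1 | t <- s] <= us} ->
    meval z s = \sum_(e <- us) mcoef s e * monom z e.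
  move=> uu; rewrite /meval /mcoef; elim: s => [|t s IH] sub /=.
    by rewrite big_nil big1 // => e _; rewrite big_nil mul0r.
  rewrite big_cons IH; last by move=> e es; apply: sub; rewrite inE es orbT.
  rewrite (bigD1_seq t.1) ?sub ?mem_head //= [in RHS](bigD1_seq t.1) ?sub ?mem_head //=.
  rewrite big_cons eqxx mulrDl -!addrA; congr (_ + (_ + _)).
  by apply: eq_bigr => e et; rewrite big_cons eq_sym (negbTE et).
pose us := undup ([seq t.1 | t <- p] ++ [seq t.1 | t <- q]).
rewrite (ev p us) ?(ev q us) ?undup_uniq //.
- by apply: eq_bigr => e _; rewrite h.
- by move=> e he; rewrite mem_undup mem_cat he orbT.
- by move=> e he; rewrite mem_undup mem_cat he.
Qed.

(** * The indices S_{N,r} and the polynomial of a vector *)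

Lemma SseqS N r : Sseq N r.+1 = flatten [seq [seq n :: s | s <- Sseq (N - n) r]
                     | n <- rev (iota 0 N.+1) & odd n && (3 <= n)%N].
Proof. by []. Qed.

Lemma mem_Sseq N r s : (s \in Sseq N r) =
  [&& size s == r, sumn s == N & all (fun n => odd n && (3 <= n)%N) s].
Proof.
elim: r N s => [|r IH] N s.
  rewrite /=; case: s => [|n s]; rewrite ?andbF //=.
    by case: eqP => [->|/eqP h]; rewrite ?inE // eq_sym (negbTE h).
  by case: ifP.
rewrite SseqS; apply/flatten_mapP/idP => [[n]|].
  rewrite mem_filter mem_rev mem_iota => /andP[hn /andP[_ hN]] /mapP[s' ].
  rewrite IH => /and3P[/eqP sz /eqP sm al] -> /=; rewrite sz eqxx hn al andbT sm.
  by apply/eqP; lia.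
case: s => [|n s]; first by case/andP.
case/and3P=> /eqP[sz] /eqP sm /andP[hn al]; rewrite /= in sm; exists n.
  by rewrite mem_filter mem_rev mem_iota hn; lia.
by apply/mapP; exists s => //; rewrite IH; apply/and3P; split; [exact/eqP | apply/eqP; lia | exact: al].
Qed.

Lemma Sseq_uniq N r : uniq (Sseq N r).
Proof.
elim: r N => [|r IH] N; first by rewrite /=; case: ifP.
rewrite SseqS; apply/allpairs_uniq_dep.
- by rewrite filter_uniq // rev_uniq iota_uniq.
- by move=> n _; apply: IH.
- by move=> [n s] [n' s'] _ _ /= [-> ->].
Qed.

Section Index.
Variables N r : nat.
Implicit Type i : 'I_(kS N r).

Lemma Sidx_mem i : Sidx i \in Sseq N r.
Proof. exact: mem_nth. Qed.

Lemma Sidx_size i : size (Sidx i) = r.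
Proof. by move: (Sidx_mem i); rewrite mem_Sseq => /and3P[/eqP]. Qed.

Lemma Sidx_sumn i : sumn (Sidx i) = N.
Proof. by move: (Sidx_mem i); rewrite mem_Sseq => /and3P[_ /eqP]. Qed.

Lemma Sidx_all i : all (fun n => odd n && (3 <= n)%N) (Sidx i).
Proof. by move: (Sidx_mem i); rewrite mem_Sseq => /and3P[]. Qed.

Lemma Sidx_inj : injective (@Sidx N r).
Proof. by move=> i k /eqP; rewrite /Sidx nth_uniq ?Sseq_uniq // => /eqP/val_inj. Qed.

Lemma Sidx_surj s : s \in Sseq N r -> exists i, Sidx i = s.
Proof.
by move=> hs; have h := hs; rewrite -index_mem in h; exists (Ordinal h); rewrite /Sidx nth_index.
Qed.
End Index.

Lemma map_predn_inj s t :
  all (fun n => odd n && (3 <= n)%N) s -> all (fun n => odd n && (3 <= n)%N) t ->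
  (map predn s == map predn t) = (s == t).
Proof.
elim: s t => [|a s IH] [|b t] //= /andP[ha hs] /andP[hb ht].
rewrite !eqseq_cons IH //; congr (_ && _); apply/eqP/eqP; lia.
Qed.

(** Covers the case N = 0, which [Tser] treats separately. *)
Lemma kS0 r : (0 < r)%N -> kS 0 r = 0%N.
Proof.
move=> r0; apply/eqP; rewrite -leqn0 leqNgt; apply/negP => h.
have := Sidx_mem (Ordinal h); rewrite mem_Sseq.
case: (Sidx _) => [|a s] /and3P[/eqP sz sm al]; first by rewrite -sz in r0.
by case/andP: al; move: sm => /=; case: (a).
Qed.

Definition vpoly (N r : nat) (v : 'rV[rat]_(kS N r)) (z : seq rat) : rat :=
  \sum_i v ord0 i * monom z (map predn (Sidx i)).

Section Poly.
Variables N r : nat.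
Implicit Type v : 'rV[rat]_(kS N r).

Lemma meval_polyV v z : meval z (polyV v) = vpoly v z.
Proof. by rewrite /meval /polyV big_map big_enum. Qed.

Lemma homsize_polyV v : homsize r (polyV v).
Proof.
apply/allP => t /mapP[i _ ->] /=; by rewrite size_map Sidx_size.
Qed.

Lemma mcoef_polyV v k : mcoef (polyV v) (map predn (Sidx k)) = v ord0 k.
Proof.
rewrite /mcoef big_map big_enum_cond /= (bigD1 k) ?eqxx //= big1 ?addr0 // => i /andP[h].
by rewrite map_predn_inj ?Sidx_all // in h; rewrite (Sidx_inj (eqP h)) eqxx.
Qed.

Lemma vpoly_inj v w : (forall z, size z = r -> vpoly v z = vpoly w z) -> v = w.
Proof.
move=> h; apply/rowP => k; rewrite -!mcoef_polyV.
apply: (@mcoef_eq r); rewrite ?homsize_polyV // => z sz; by rewrite !meval_polyV h.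
Qed.

Lemma vpoly_even v x z : vpoly v (- x :: z) = vpoly v (x :: z).
Proof.
apply: eq_bigr => i _; move: (Sidx_all i); case: (Sidx i) => [|a s] /=.
  by rewrite !monom_e0.
by rewrite !monom_cons => /andP[/andP[oa a3] _]; rewrite exprNn -signr_odd (_ : odd a.-1 = false) ?mul1r //; lia.
Qed.

Lemma inWP v : (2 <= r)%N -> inW v <-> (forall x y z, (size z).+2 = r ->
   vpoly v [:: x, y & z] = vpoly v [:: y - x, y & z] - vpoly v [:: y - x, x & z]).
Proof.
move=> r2.
have vars z : size z = r -> [seq meval z (mvar r k) | k <- iota 2 (r - 2)] = drop 2 z.
  move=> sz; apply: (@eq_from_nth _ 0); rewrite size_map size_iota ?size_drop ?sz // => i hi.
  by rewrite (nth_map 0%N) ?size_iota // nth_iota // meval_var ?nth_drop //; lia.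
have hrest : all (homsize r) [seq mvar r k | k <- iota 2 (r - 2)].
  by apply/allP => _ /mapP[k _ ->]; apply: homsize_var.
have hs i : homsize r (msub (mvar r 1) (mvar r i)) by rewrite homsize_sub ?homsize_var.
have key x y z : (size z).+2 = r ->
  meval [:: x, y & z] (msub
     (msubst r (polyV v) [:: msub (mvar r 1) (mvar r 0), mvar r 1 & [seq mvar r k | k <- iota 2 (r - 2)]])
     (msubst r (polyV v) [:: msub (mvar r 1) (mvar r 0), mvar r 0 & [seq mvar r k | k <- iota 2 (r - 2)]]))
  = vpoly v [:: y - x, y & z] - vpoly v [:: y - x, x & z].
  move=> sz; rewrite meval_sub !meval_subst !meval_polyV /= meval_sub -map_comp /comp /=.
  by rewrite (vars [:: x, y & z]) //= drop0 !meval_var //=; lia.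
split=> [h x y z sz | h].
  by rewrite -key // -meval_polyV; apply: meq_meval.
apply: (@mcoef_eq r); first exact: homsize_polyV.
  by apply: homsize_sub; apply: homsize_subst; apply/and3P; split; do ?[exact: homsize_var | exact: hs].
move=> [|x [|y z]] //= sz; try by rewrite -sz in r2.
by rewrite key // meval_polyV h.
Qed.

(** Exchanging x and y changes the sign of the right-hand side of the defining equation, because the
    first argument [y - x] enters through an even power. *)
Lemma inW_anti v x y z : (2 <= r)%N -> inW v -> (size z).+2 = r ->
  vpoly v [:: x, y & z] = - vpoly v [:: y, x & z].
Proof.
move=> r2 /(inWP _ r2) h sz; rewrite (h x y z sz) (h y x z sz) -(vpoly_even v (x - y)).
by rewrite -(vpoly_even v (x - y)) !opprB.
Qed.

End Poly.

(** * The maps phi^(j) as operators on functions *)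

Definition omit (z : seq rat) (s o : nat) (r : nat) : seq rat :=
  [seq z`_k | k <- iota s r & k != o].

Definition phi_args (r j : nat) (z : seq rat) (i o : nat) : seq rat :=
  take (r - j) z ++ (z`_i.+1 - z`_i) :: omit z (r - j) o j.

Definition phi_fun (r j : nat) (F : seq rat -> rat) (z : seq rat) : rat :=
  F z + \sum_(i <- iota (r - j) (j - 1)) (F (phi_args r j z i i.+1) - F (phi_args r j z i i)).

(** The polynomial inside [phi], before the restricted totally even part is taken. *)
Definition phi_poly (N r j : nat) (v : 'rV[rat]_(kS N r)) : mpoly :=
  let Q := polyV v in
  let x := mvar r in
  let args (i omit : nat) :=
    [seq x k | k <- iota 0 (r - j)] ++ [:: msub (x i.+1) (x i)]
      ++ [seq x k | k <- iota (r - j) j & k != omit] in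
  madd Q (flatten [seq msub (msubst r Q (args i i.+1)) (msubst r Q (args i i))
                              | i <- iota (r - j) (j - 1)]).

Lemma phiE (N r j : nat) (v : 'rV[rat]_(kS N r)) k :
  phi j v ord0 k = mcoef (phi_poly j v) (map predn (Sidx k)).
Proof. by rewrite mxE. Qed.

Lemma homsize_phi (N r j : nat) (v : 'rV[rat]_(kS N r)) : homsize r (phi_poly j v).
Proof.
rewrite homsize_cat homsize_polyV; apply: homsize_flatten => i _.
have hv (s : seq nat) : all (homsize r) [seq mvar r k | k <- s].
  by apply/allP => _ /mapP[k _ ->]; apply: homsize_var.
by apply: homsize_sub; apply: homsize_subst; rewrite !all_cat !hv andbT all_seq1 homsize_sub ?homsize_var.
Qed.

Lemma meval_vars z r (s : seq nat) : size z = r -> all (fun k => k < r)%N s ->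
  [seq meval z q | q <- [seq mvar r k | k <- s]] = [seq z`_k | k <- s].
Proof.
move=> sz /allP h; rewrite -map_comp; apply/eq_in_map => k ks /=.
by rewrite meval_var //; apply: h.
Qed.

Lemma map_nth_iota_take (z : seq rat) a b : (a + b <= size z)%N ->
  [seq z`_k | k <- iota a b] = take b (drop a z).
Proof.
move=> h; apply: (@eq_from_nth rat 0); rewrite size_map size_iota.
  by rewrite size_takel // size_drop; lia.
by move=> i hi; rewrite (nth_map 0%N) ?size_iota // nth_iota // nth_take // nth_drop.
Qed.

Lemma meval_phi (N r j : nat) (v : 'rV[rat]_(kS N r)) z : (j <= r)%N -> size z = r ->
  meval z (phi_poly j v) = phi_fun r j (vpoly v) z.
Proof.
move=> jr sz; rewrite meval_cat meval_polyV meval_flatten; congr (_ + _).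
have E i o : (i < r - 1)%N -> [seq meval z q | q <- [seq mvar r k | k <- iota 0 (r - j)] ++
    [:: msub (mvar r i.+1) (mvar r i)] ++ [seq mvar r k | k <- iota (r - j) j & k != o]]
    = phi_args r j z i o.
  move=> hi; rewrite /phi_args /omit !map_cat /= !meval_vars //; last first.
  - by apply/allP => k; rewrite mem_iota; lia.
  - by apply/allP => k; rewrite mem_filter mem_iota; lia.
  rewrite map_nth_iota_take ?drop0; last by rewrite sz leq_subr.
  by rewrite meval_sub !meval_var //; lia.
rewrite big_seq [RHS]big_seq; apply: eq_bigr => i; rewrite mem_iota => hi.
by rewrite meval_sub !meval_subst !meval_polyV !E //; lia.
Qed.

(** * The maps phi^(j) as matrices *)

Definition ihara_monom (m : seq nat) : mpoly :=
  let a := (head 0%N m).-1 in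
  ihara (size m) [:: ([:: a], 1)] a [:: (map predn (behead m), 1)].

Lemma ecoefE m n : ecoef m n = mcoef (ihara_monom m) (map predn n).
Proof. by []. Qed.

Lemma homsize_vars r (s : seq nat) : all (homsize r) [seq mvar r k | k <- s].
Proof. by apply/allP => _ /mapP[k _ ->]; apply: homsize_var. Qed.

Lemma homsize_ihara m : homsize (size m) (ihara_monom m).
Proof.
rewrite homsize_cat; apply/andP; split.
  by apply: homsize_mul; apply: homsize_subst; rewrite ?homsize_vars // all_seq1 homsize_var.
apply: homsize_flatten => i _; apply: homsize_sub; rewrite ?homsize_scale.
  by apply: homsize_mul; apply: homsize_subst; rewrite ?homsize_vars // all_seq1 homsize_sub ?homsize_var.
by apply: homsize_mul; apply: homsize_subst; rewrite ?homsize_vars // all_seq1 homsize_sub ?homsize_var.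
Qed.

Lemma monom_seq1 x a : monom [:: x] [:: a] = x ^+ a.
Proof. by rewrite monom_cons monom_nil mulr1. Qed.

Lemma meval_seq1 z e : meval z [:: (e, 1)] = monom z e.
Proof. by rewrite /meval big_seq1 mul1r. Qed.

Lemma omit_drop z s o r : omit z s (s + o) r = omit (drop s z) 0 o r.
Proof.
rewrite /omit -[s in iota s]addn0 iotaDl filter_map -map_comp.
rewrite (eq_filter (a2 := fun k => k != o)); last by move=> k /=; rewrite eqn_add2l.
by apply: eq_map => k /=; rewrite nth_drop.
Qed.

(** An odd first index makes the exponent [a] even, so the sign of the Ihara action is 1 and both
    differences may be written [z]_i.+1 - z[_i], the shape occurring in [phi_fun]. *)
Lemma meval_ihara m z : size z = size m -> (0 < size m)%N -> odd (head 0%N m) ->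
  let a := (head 0%N m).-1 in let g := map predn (behead m) in
  meval z (ihara_monom m) = z`_0 ^+ a * monom (behead z) g
   + \sum_(i <- iota 0 (size m - 1)) ((z`_i.+1 - z`_i) ^+ a * monom (omit z 0 i.+1 (size m)) g
                                   - (z`_i.+1 - z`_i) ^+ a * monom (omit z 0 i (size m)) g).
Proof.
move=> sz m0 om a g.
rewrite meval_cat meval_flatten; congr (_ + _).
  rewrite meval_mul !meval_subst [map _ [:: _]]/= meval_var // !meval_seq1 monom_seq1 meval_vars //; last first.
    by apply/allP => k; rewrite mem_iota; lia.
  rewrite map_nth_iota_take; last by rewrite sz; lia.
  by rewrite drop1 take_oversize // size_behead sz subn1.
rewrite big_seq [RHS]big_seq; apply: eq_bigr => i; rewrite mem_iota => hi.
rewrite meval_sub meval_scale !meval_mul !meval_subst ![map _ [:: _]]/= !meval_sub.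
rewrite !meval_var //; try lia.
rewrite !meval_seq1 !monom_seq1 !meval_vars //.
- have ea : odd a = false by rewrite /a; move: om; case: (head _ _) => //= n /negbTE.
  have s1 : (-1) ^+ a = 1 :> rat by rewrite -signr_odd ea.
  by rewrite -/a s1 -[z`_i - _]opprB exprNn s1 !mul1r.
- by apply/allP => k; rewrite mem_filter mem_iota; lia.
- by apply/allP => k; rewrite mem_filter mem_iota; lia.
Qed.

Lemma mcoef_shift p c q p' e : size p = size p' ->
  mcoef [seq (p ++ t.1, c * t.2) | t <- q] (p' ++ e) = (p == p')%:R * (c * mcoef q e).
Proof.
move=> sp; rewrite /mcoef big_map /=; case: eqP => [->|/eqP ne].
  by rewrite mul1r mulr_sumr; apply: eq_bigl => t; rewrite eqseq_cat ?eqxx.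
by rewrite mul0r big1 // => t; rewrite eqseq_cat // (negbTE ne).
Qed.

Lemma meval_shift p c q z1 z2 : size p = size z1 ->
  meval (z1 ++ z2) [seq (p ++ t.1, c * t.2) | t <- q] = c * (monom z1 p * meval z2 q).
Proof.
move=> sp; rewrite /meval big_map !mulr_sumr; apply: eq_bigr => t _ /=.
by rewrite monom_cat //; ring.
Qed.

Lemma phi_fun_sum (I : finType) r j (c : I -> rat) (F : I -> seq rat -> rat) z :
  phi_fun r j (fun z => \sum_i c i * F i z) z = \sum_i c i * phi_fun r j (F i) z.
Proof.
rewrite /phi_fun; under [RHS]eq_bigr => i _ do rewrite mulrDr mulr_sumr.
rewrite [RHS]big_split; congr (_ + _); rewrite exchange_big; apply: eq_bigr => k _ /=.
by rewrite -sumrB; apply: eq_bigr => i _; rewrite mulrBr.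
Qed.

(** The first [r - j] variables pass through unchanged. In the rest, the variable replaced by a
    difference carries the one-variable factor of the Ihara action, and the list with one omission
    carries the other factor. *)
Lemma phi_fun_monom r j s z : (0 < j <= r)%N -> size s = r -> size z = r ->
  all (fun n => odd n && (3 <= n)%N) s ->
  phi_fun r j (monom^~ (map predn s)) z =
  monom (take (r - j) z) (map predn (take (r - j) s)) *
  meval (drop (r - j) z) (ihara_monom (drop (r - j) s)).
Proof.
move=> /andP[j0 jr] ss sz al; set s1 := take _ s; set s2 := drop _ s; set z1 := take _ z; set z2 := drop _ z.
have es : s = s1 ++ s2 by rewrite cat_take_drop.
have ez : z = z1 ++ z2 by rewrite cat_take_drop.
have s2j : size s2 = j by rewrite size_drop ss; lia.
have z2j : size z2 = j by rewrite size_drop sz; lia.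
have szs : size z1 = size (map predn s1) by rewrite size_map !size_take ss sz.
have al2 : all (fun n => odd n && (3 <= n)%N) s2 by rewrite es all_cat in al; case/andP: al.
rewrite meval_ihara ?s2j ?z2j //; last by move: al2 s2j; case: (s2) => [|n l] //=; [lia | case/andP=> /andP[]].
have hcons y w : monom (z1 ++ y :: w) (map predn s) =
    monom z1 (map predn s1) * (y ^+ (head 0%N s2).-1 * monom w (map predn (behead s2))).
  rewrite es map_cat monom_cat //; move: s2j; case: (s2) => [|n l] /= ?; first by lia.
  by rewrite monom_cons.
rewrite /phi_fun mulrDr; congr (_ + _).
  rewrite {1}ez -hcons; congr (monom (_ ++ _) _).
  by move: z2j; case: (z2) => [|y w] //= ?; lia.
rewrite -[X in iota X _]addn0 iotaDl big_map mulr_sumr; apply: eq_bigr => i _.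
rewrite /phi_args -/z1 -addnS (omit_drop z _ i.+1) (omit_drop z _ i) -/z2 !hcons -!mulrBr.
by rewrite /z2 !nth_drop; ring.
Qed.

Lemma phi_mulmx (N r j : nat) (v : 'rV[rat]_(kS N r)) : (0 < j <= r)%N ->
  phi j v = v *m Ejmx N r j.
Proof.
move=> hj; have /andP[j0 jr] := hj.
apply/rowP => k; rewrite phiE mxE.
(* [J m] is the contribution of index [m]: the prefix monomial times the Ihara action of the suffix.
   Their sum [q] has the same values as [phi_poly j v], and its coefficients are the entries of the
   matrix product. *)
pose J (m : 'I_(kS N r)) := [seq (map predn (take (r - j) (Sidx m)) ++ t.1, v ord0 m * t.2)
   | t <- ihara_monom (drop (r - j) (Sidx m))].
pose q := flatten [seq J m | m <- enum 'I_(kS N r)].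
have szd (m : 'I_(kS N r)) : size (drop (r - j) (Sidx m)) = j by rewrite size_drop Sidx_size; lia.
have szt (m : 'I_(kS N r)) : size (take (r - j) (Sidx m)) = (r - j)%N.
  by rewrite size_takel // Sidx_size leq_subr.
have -> : mcoef (phi_poly j v) (map predn (Sidx k)) = mcoef q (map predn (Sidx k)).
  apply: (@mcoef_eq r); first exact: homsize_phi.
    apply: homsize_flatten => m _; apply/allP => _ /mapP[t tI ->] /=.
    rewrite size_cat size_map szt (homsizeP (homsize_ihara _) tI) szd; apply/eqP; lia.
  move=> z sz; rewrite meval_phi // phi_fun_sum meval_flatten big_enum /=.
  apply: eq_bigr => m _; rewrite phi_fun_monom ?Sidx_size ?Sidx_all //.
  by rewrite -{3}(cat_take_drop (r - j) z) meval_shift // size_map szt size_takel // sz leq_subr.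
rewrite /mcoef big_flatten big_map big_enum /=; apply: eq_bigr => m _; rewrite mxE ecoefE.
rewrite -/(mcoef (J m) _) -{1}(cat_take_drop (r - j) (Sidx k)) map_cat.
rewrite mcoef_shift ?size_map ?szt //.
rewrite map_predn_inj; first by ring.
- by have := Sidx_all m; rewrite -{1}(cat_take_drop (r - j) (Sidx m)) all_cat => /andP[].
- by have := Sidx_all k; rewrite -{1}(cat_take_drop (r - j) (Sidx k)) all_cat => /andP[].
Qed.

(** In phi^(r) the term exchanging the first two variables is -P by the defining equation. Each
    other term of phi^(r) has a counterpart in phi^(r-1) with the first two arguments swapped, and
    antisymmetry cancels the pair; one copy of P remains. *)
Lemma inW_phi (N r : nat) (v : 'rV[rat]_(kS N r)) : (3 <= r)%N -> inW v ->
  phi r v + phi r.-1 v = v.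
Proof.
move=> r3 hv; have r2 : (2 <= r)%N by lia.
apply/rowP => k; rewrite mxE !phiE -mcoef_cat -mcoef_polyV.
apply: (@mcoef_eq r); [by rewrite homsize_cat !homsize_phi | exact: homsize_polyV |].
move=> z sz; rewrite meval_cat !meval_phi ?meval_polyV //; last by lia.
rewrite /phi_fun subnn (_ : r - r.-1 = 1)%N; last by lia.
have -> : (r.-1 - 1 = r - 2)%N by lia.
have -> : (r - 1 = (r - 2).+1)%N by lia.
case: z sz => [|x [|y z]] sz; rewrite /= in sz; try (exfalso; lia).
rewrite big_cons /=.
have h2 : [seq [:: x, y & z]`_k | k <- iota 2 (r - 2)] = z.
  by rewrite map_nth_iota_take /= ?sz ?drop0 ?take_oversize //; lia.
have o1 : omit [:: x, y & z] 0 1 r = x :: z.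
  rewrite -{2}h2 /omit; have -> : (r = (r - 2).+2)%N by lia.
  rewrite /= subSS subSS subn0; congr (_ :: map _ _); apply/all_filterP/allP => i.
  by rewrite mem_iota; lia.
have o0 : omit [:: x, y & z] 0 0 r = y :: z.
  rewrite -{2}h2 /omit; have -> : (r = (r - 2).+2)%N by lia.
  rewrite /= subSS subSS subn0; congr (_ :: map _ _); apply/all_filterP/allP => i.
  by rewrite mem_iota; lia.
rewrite {1 2}/phi_args !subnn /= o1 o0.
have /(inWP _ r2) hW := hv.
(* Here [a - b] is P, and [b - a] is the [i = 0] term of phi^(r). *)
rewrite (hW x y z sz) /= (_ : forall a b c d : rat, a - b + (b - a + c) + (a - b + d) = a - b + (c + d)); last by move=> *; ring.
rewrite -big_split /= big_seq big1 ?addr0 // => i; rewrite mem_iota => hi.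
rewrite /phi_args subnn (_ : r - r.-1 = 1)%N; last by lia.
have om o : (0 < o)%N -> omit [:: x, y & z] 0 o r = x :: omit [:: x, y & z] 1 o r.-1.
  move=> o0'; rewrite /omit; have -> : (r = (r.-1).+1)%N by lia.
  by rewrite /= (_ : (0 != o)%N) //; lia.
have so o : (1 <= o < r)%N -> size (omit [:: x, y & z] 1 o r.-1) = (r - 2)%N.
  move=> ho; rewrite /omit size_map size_filter.
  have := count_predC (pred1 o) (iota 1 r.-1).
  by rewrite count_uniq_mem ?iota_uniq // mem_iota size_iota; set c := count _ _; lia.
rewrite !om; try lia.
(* Swapping [x] into second place makes the terms of the two sums opposite. *)
rewrite /= !(inW_anti x) // ?so; try lia.
ring.
Qed.

(** * Binary forms and the substitution U of order 3 *)

Section Forms.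
Variable w : nat.
Hypothesis w_even : ~~ odd w.
Implicit Types u f : 'rV[rat]_w.+1.

Definition hform u (x y : rat) : rat := \sum_(i < w.+1) u ord0 i * (x ^+ i * y ^+ (w - i)).

Lemma hform_lin a u u' x y : hform (a *: u + u') x y = a * hform u x y + hform u' x y.
Proof.
rewrite /hform mulr_sumr -big_split; apply: eq_bigr => i _ /=; rewrite !mxE; ring.
Qed.

Lemma hformD u u' x y : hform (u + u') x y = hform u x y + hform u' x y.
Proof. by rewrite -[u]scale1r hform_lin !mul1r scale1r. Qed.

Lemma hformZ a u x y : hform (a *: u) x y = a * hform u x y.
Proof. by rewrite -[_ *: _]addr0 hform_lin /hform [X in _ + X]big1 ?addr0 // => i _; rewrite mxE mul0r. Qed.

Lemma hformN u x y : hform (- u) x y = - hform u x y.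
Proof. by rewrite -scaleN1r hformZ mulN1r. Qed.

Lemma hform_row (v : 'rV[rat]_w.+1) x : hform v x 1 = (\poly_(i < w.+1) v ord0 (inord i)).[x].
Proof.
rewrite horner_poly; apply: eq_bigr => i _; by rewrite expr1n mulr1 inord_val.
Qed.

Lemma hform_inj u u' : (forall n : nat, hform u n.+1%:R 1 = hform u' n.+1%:R 1) -> u = u'.
Proof.
move=> h; apply/eqP; rewrite -subr_eq0; apply/eqP; set v := u - u'.
have P0 : \poly_(i < w.+1) v ord0 (inord i) = 0.
  by apply: poly_nat_eq0 => n; rewrite -hform_row /v hformD hformN h subrr.
apply/rowP => i; rewrite [RHS]mxE -[i]inord_val.
by have := coef_poly w.+1 (fun i => v ord0 (inord i)) i; rewrite P0 coef0 ltn_ord.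
Qed.

Lemma hform_opp u x y : hform u (- x) (- y) = hform u x y.
Proof.
apply: eq_bigr => i _; rewrite -[- x]mulN1r -[- y]mulN1r !exprMn mulrACA -exprD subnKC ?leq_ord //.
by rewrite -signr_odd (negbTE w_even) expr0 mul1r.
Qed.

Lemma hform_rev u x y : hform (\row_i u ord0 (rev_ord i)) x y = hform u y x.
Proof.
rewrite /hform (reindex_inj rev_ord_inj); apply: eq_bigr => i _.
by rewrite mxE rev_ordK /= subSS subKn ?leq_ord // mulrC [_ * y ^+ _]mulrC mulrC.
Qed.

Lemma hform_alt u x y : hform (\row_i ((-1) ^+ i * u ord0 i)) x y = hform u (- x) y.
Proof. by apply: eq_bigr => i _; rewrite mxE [(- x) ^+ i]exprNn; ring. Qed.

(* Right multiplication by [Umx] is the substitution (x, y) -> (y, - x - y), of order 3. *)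
Definition Umx : 'M[rat]_w.+1 := \matrix_(i, j) ((-1) ^+ (w - i) * 'C(w - i, j)%:R).

Lemma hform_U u x y : hform (u *m Umx) x y = hform u y (- x - y).
Proof.
rewrite /hform; under eq_bigr => j _ do rewrite mxE mulr_suml.
rewrite exchange_big; apply: eq_bigr => i _ /=.
under eq_bigr => j _ do rewrite mxE -!mulrA.
rewrite -mulr_sumr; congr (_ * _).
have -> : - x - y = - (y + x) by ring.
rewrite [(- (y + x)) ^+ _]exprNn exprDn mulrCA -mulr_sumr; congr (_ * _).
(* The binomial sum is extended to all exponents up to [w]; the added binomial coefficients
   vanish. *)
have wi : ((w - i).+1 <= w.+1)%N by lia.
rewrite (big_ord_widen_cond _ (fun _ => true) (fun j => (y ^+ (w - i - j) * x ^+ j) *+ 'C(w - i, j)) wi) /=.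
rewrite mulr_sumr [RHS]big_mkcond; apply: eq_bigr => j _.
case: ltnP => hj; last by rewrite bin_small // mul0r.
rewrite -mulr_natl; have -> : (w - j = i + (w - i - j))%N by have := leq_ord i; lia.
by rewrite exprD; ring.
Qed.

(** The forms on which the group S_3 permuting x, y, - x - y acts through the sign character. *)
Definition skew_inv f := (forall x y, hform f y x = - hform f x y)
  /\ (forall x y, hform f y (- x - y) = hform f x y).

Section SkewInv.
Variable f : 'rV[rat]_w.+1.
Hypothesis ff : skew_inv f.

Lemma skew_inv_rev i : f ord0 (rev_ord i) = - f ord0 i.
Proof.
suff /rowP/(_ i) : \row_i f ord0 (rev_ord i) = - f by rewrite !mxE.
by apply: hform_inj => n; rewrite hform_rev hformN ff.1.
Qed.

Lemma skew_inv_swap x y : hform f x (- x - y) = - hform f x y.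
Proof.
rewrite ff.1 -(ff.2 _ x); congr (- hform f _ _); ring.
Qed.

Definition dehom := \poly_(i < w.+1) f ord0 (inord i).

Lemma hform_dehom x : hform f x 1 = dehom.[x].
Proof. exact: hform_row. Qed.

Lemma coef_dehom (i : 'I_w.+1) : dehom`_i = f ord0 i.
Proof. by rewrite coef_poly ltn_ord inord_val. Qed.

Lemma dehom_eq0 : dehom = 0 -> f = 0.
Proof. by move=> h; apply/rowP => i; rewrite mxE -coef_dehom h coef0. Qed.

(** The transposition (x, y) -> (x, - x - y) changes the sign of f. At y = 1 it multiplies the
    lowest coefficient, of index m, by (-1)^(w - m), which is 1 for even m; that coefficient is thus
    its own negative. *)
Lemma skew_inv_coef_even m : ~~ odd m -> (forall i, (i < m)%N -> dehom`_i = 0) -> dehom`_m = 0.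
Proof.
move=> em h.
have key : dehom = - \sum_(i < w.+1) f ord0 i *: ('X^i * (- 'X - 1) ^+ (w - i)).
  apply/eqP; rewrite -subr_eq0; apply/eqP; apply: poly_nat_eq0 => n.
  rewrite opprK hornerD horner_sum -hform_dehom -[hform f _ 1]opprK -skew_inv_swap /hform.
  apply/eqP; rewrite addrC subr_eq0; apply/eqP.
  by apply: eq_bigr => i _; rewrite !hornerE.
case: (ltnP m w.+1) => hm; last by rewrite nth_default // (leq_trans (size_poly _ _)).
have e : dehom`_m = - dehom`_m.
  rewrite {1}key coefN coef_sum (bigD1 (Ordinal hm)) //= big1 => [|i im].
    rewrite addr0 coefZ coefXnM ltnn subnn -(coef_dehom (Ordinal hm)) /=.
    rewrite -horner_coef0 horner_exp hornerD !hornerN hornerX hornerC oppr0 add0r.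
    by rewrite -signr_odd oddB // (negbTE w_even) (negbTE em) expr0 mulr1.
  rewrite coefZ; case: (ltnP i m) => hi; first by rewrite -coef_dehom h // mul0r.
  rewrite coefXnM; suff -> : (m < i)%N by rewrite mulr0.
  by rewrite ltn_neqAle hi andbT; apply: contra im => /eqP mi; apply/eqP/val_inj.
lra.
Qed.

(** With [c = w %/ 6] and [m = 2c + 1], all coefficients below [m] vanish, so X^m divides [dehom],
    and by symmetry so does (X + 1)^m. With three more roots a nonzero [dehom] would have degree at
    least 2m + 3, while skewness bounds the degree by w - m; but 3m + 3 = 6c + 6 > w. *)
Lemma skew_inv_eq0 : (forall k, (k < w %/ 6)%N -> dehom`_(2 * k).+1%N = 0) -> f = 0.
Proof.
move=> h; set c := (w %/ 6)%N in h.
have low m : (m < (2 * c).+1)%N -> dehom`_m = 0.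
  elim/ltn_ind: m => m IH hm; case om: (odd m); last first.
    by apply: skew_inv_coef_even; rewrite ?om // => i im; apply: IH => //; lia.
  have -> : m = (2 * (m./2)).+1%N by lia.
  apply: h; lia.
apply: dehom_eq0; apply/eqP/negPn/negP => p0.
pose m := (2 * c).+1%N.
have dX : 'X^m %| dehom.
  apply/dvdpP; exists (drop_poly m dehom); rewrite -[LHS](poly_take_drop m).
  rewrite (_ : take_poly m dehom = 0) ?add0r //.
  by apply/polyP => i; rewrite coef_take_poly coef0; case: ifP => // /low.
have sym : dehom = - (dehom \Po (- 'X - 1)).
  apply/eqP; rewrite -subr_eq0; apply/eqP; apply: poly_nat_eq0 => n.
  rewrite opprK hornerD horner_comp hornerD !hornerN hornerX hornerC -!hform_dehom.
  by have := ff.1 1 (- n.+1%:R - 1); rewrite ff.2 => ->; rewrite subrr.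
have dX1 : ('X + 1) ^+ m %| dehom.
  case/dvdpP: dX => q eq; rewrite sym dvdpNr eq comp_polyM comp_Xn_poly dvdp_mull //.
  by rewrite -[- 'X - 1]opprD exprNn dvdp_mull.
(* The points (1, 1), (-2, 1) and (-1/2, 1) are each fixed by one of the three transpositions, so f
   vanishes there. *)
have r1 : root dehom 1 by rewrite /root -hform_dehom; have := ff.1 1 1; lra.
have r2 : root dehom (-2).
  by rewrite /root -hform_dehom; have := skew_inv_swap (-2) 1; rewrite (_ : - (-2) - 1 = 1) //; lra.
have r3 : root dehom (-1/2).
  rewrite /root -hform_dehom; have := ff.1 1 (-1/2); have := ff.2 (-1/2) 1.
  by rewrite (_ : - (-1/2) - 1 = -1/2) //; lra.
(* Skewness pairs the coefficients of index j and w - j, so the top [m] of them vanish as well. *)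
have sz : (size dehom <= w.+1 - m)%N.
  apply/leq_sizeP => j hj; case: (ltnP j w.+1) => hjw; last by rewrite nth_default // (leq_trans (size_poly _ _)).
  rewrite (coef_dehom (Ordinal hjw)) -[X in f _ X]rev_ordK skew_inv_rev -coef_dehom low ?oppr0 //=; lia.
pose D := ('X - 0%:P) ^+ m * (('X - (-1)%:P) ^+ m * (('X - 1%:P) * (('X - (-2)%:P) * ('X - (-1/2)%:P)))) : {poly rat}.
have cp (a b : rat) : a != b -> coprimep ('X - a%:P) ('X - b%:P).
  by move=> ab; rewrite coprimep_XsubC2 // subr_eq0 eq_sym.
have dD : D %| dehom.
  rewrite /D !Gauss_dvdp ?coprimepMr ?coprimep_expl ?coprimep_expr ?cp //.
  rewrite subr0 dX polyCN opprK dX1 !dvdp_XsubCl r1 r2 r3 //.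
have := dvdp_leq p0 dD.
have mon (a : rat) k : ('X - a%:P) ^+ k \is monic by rewrite monic_exp ?monicXsubC.
rewrite /D !size_Mmonic ?monic_neq0 ?rpredM ?monicXsubC ?mon //.
rewrite !size_exp_XsubC !size_XsubC => H; have := leq_trans H sz; rewrite /m /c; lia.
Qed.

End SkewInv.
End Forms.

(** * The rank of 1 + U + U^2 on even skew-symmetric forms *)

Section Rank.
Variable w : nat.
Hypothesis w_even : ~~ odd w.
Implicit Types u f : 'rV[rat]_w.+1.

Lemma skew_inv_lin a f g : skew_inv f -> skew_inv g -> skew_inv (a *: f + g).
Proof.
move=> [f1 f2] [g1 g2]; split=> x y; rewrite !hform_lin; last by rewrite f2 g2.
by rewrite f1 g1; ring.
Qed.

Lemma hform0 x y : hform (0 : 'rV[rat]_w.+1) x y = 0.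
Proof. by rewrite /hform big1 // => i _; rewrite mxE mul0r. Qed.

Lemma skew_inv0 : skew_inv (0 : 'rV[rat]_w.+1).
Proof. by split=> x y; rewrite !hform0 ?oppr0. Qed.

Lemma skew_inv_comb m (y : 'rV_m) (M : 'M_(m, w.+1)) :
  (forall i, skew_inv (row i M)) -> skew_inv (y *m M).
Proof.
move=> h; rewrite mulmx_sum_row; elim/big_rec: _ => [|i g _ hg]; first exact: skew_inv0.
exact: skew_inv_lin.
Qed.

Lemma skew_inv_nat f : (forall n : nat, hform f 1 n.+1%:R = - hform f n.+1%:R 1) ->
  (forall n : nat, hform f 1 (- n.+1%:R - 1) = hform f n.+1%:R 1) -> skew_inv f.
Proof.
move=> h1 h2.
have e1 : \row_i f ord0 (rev_ord i) = - f by apply: hform_inj => n; rewrite hform_rev hformN h1.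
have e2 : f *m Umx w = f by apply: hform_inj => n; rewrite hform_U // h2.
by split=> x y; [rewrite -hform_rev e1 hformN | rewrite -hform_U // e2].
Qed.

Lemma skew_inv_mulU f : skew_inv f -> f *m Umx w = f.
Proof. by move=> [_ h]; apply: hform_inj => n; rewrite hform_U // h. Qed.

Definition odd_coefs : 'M[rat]_(w.+1, w %/ 6) := \matrix_(i, k) (i == (2 * k).+1 :> nat)%:R.

Lemma mul_odd_coefs f k : (f *m odd_coefs) ord0 k = (dehom f)`_(2 * k).+1%N.
Proof.
have hk : ((2 * k).+1 < w.+1)%N by have := ltn_ord k; lia.
rewrite mxE (bigD1 (Ordinal hk)) //= mxE eqxx mulr1 -coef_dehom big1 ?addr0 // => i ik.
rewrite mxE (_ : (i == (2 * k).+1 :> nat) = false) ?mulr0 //.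
by apply: contraNF ik => /eqP e; apply/eqP/val_inj.
Qed.

(** By [skew_inv_eq0], reading off [w %/ 6] odd coefficients is injective on skew-invariant
    forms. *)
Lemma skew_inv_rank m (M : 'M_(m, w.+1)) : (forall i, skew_inv (row i M)) ->
  (\rank M <= w %/ 6)%N.
Proof.
move=> h; rewrite -(mxrank_mul_ker M odd_coefs).
suff -> : (M :&: kermx odd_coefs)%MS = 0 by rewrite mxrank0 addn0 rank_leq_col.
apply/eqP/rowV0P => v; rewrite sub_capmx => /andP[/submxP[y ->] /sub_kermxP hv].
apply: skew_inv_eq0 => //; first exact: skew_inv_comb.
by move=> k hk; rewrite -(mul_odd_coefs _ (Ordinal hk)) hv mxE.
Qed.

(** Oddness in x turns the symmetries into f(x + y, y) = f(x, y). Hence f(n, 1) = f(1, 1) for all n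
    >= 1, and f(1, 1) = 0 by skewness. *)
Lemma skew_inv_alt_eq0 f : skew_inv f -> (forall x y, hform f (- x) y = - hform f x y) -> f = 0.
Proof.
move=> [h1 h2] h3.
have step x y : hform f (x + y) y = hform f x y.
  by rewrite -[RHS]h2 [RHS]h1 -(opprD x y) h3 opprK.
have z n : hform f n.+1%:R 1 = 0.
  elim: n => [|n IH]; first by have := h1 1 1; lra.
  by rewrite -natr1 step.
by apply: hform_inj => n; rewrite z hform0.
Qed.

(* In the coordinates a = x, b = y, c = - x - y permuted by S_3, this is up to
   sign the discriminant times e_3 ^ (2k+1) times a power of e_2. *)
Definition basis_fun (k : nat) (x y : rat) : rat :=
  (x - y) * (2 * x + y) * (x + 2 * y) * (x * y * (x + y)) ^+ (2 * k).+1
  * (x ^+ 2 + x * y + y ^+ 2) ^+ (w./2 - 3 * k - 3).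

(** [basis_fun] at y = 1 with its power of x split off. The constant term is -2, and its being
    nonzero gives independence. *)
Definition basis_cofactor (k : nat) : {poly rat} :=
  ('X - 1) * (2%:P * 'X + 1) * ('X + 2%:P) * ('X + 1) ^+ (2 * k).+1
  * ('X ^+ 2 + 'X + 1) ^+ (w./2 - 3 * k - 3).

Definition basis_poly (k : nat) : {poly rat} := basis_cofactor k * 'X ^+ (2 * k).+1.

Lemma size_basis_poly k : (k < w %/ 6)%N -> (size (basis_poly k) <= w.+1)%N.
Proof.
move=> hk.
have s1 : (size ('X - 1 : {poly rat})%R <= 2)%N by rewrite size_XsubC.
have s2 : (size (2%:P * 'X + 1 : {poly rat})%R <= 2)%N by rewrite size_MXaddC; case: ifP => // _; rewrite ltnS size_polyC_leq1.
have s3 : (size ('X + 2%:P : {poly rat})%R <= 2)%N by rewrite size_XaddC.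
have s4 : (size ('X + 1 : {poly rat})%R <= 2)%N by rewrite size_XaddC.
have s5 : (size ('X ^+ 2 + 'X + 1 : {poly rat})%R <= 3)%N.
  apply: leq_trans (size_polyD _ _) _; rewrite geq_max size_poly1 andbT.
  by apply: leq_trans (size_polyD _ _) _; rewrite size_polyXn size_polyX.
have s6 : (size ('X : {poly rat})%R <= 2)%N by rewrite size_polyX.
have M (p q : {poly rat}) a b : (size p <= a.+1)%N -> (size q <= b.+1)%N -> (size (p * q)%R <= (a + b).+1)%N.
  by move=> hp hq; apply: leq_trans (size_polyMleq _ _) _; lia.
have E (p : {poly rat}) n a : (size p <= a.+1)%N -> (size (p ^+ n)%R <= (a * n).+1)%N.
  move=> hp; apply: leq_trans (size_poly_exp_leq _ _) _; rewrite ltnS leq_mul2r; apply/orP; right; lia.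
have := M _ _ _ _ (M _ _ _ _ (M _ _ _ _ (M _ _ _ _ (M _ _ _ _ s1 s2) s3) (E _ (2 * k).+1 _ s4)) (E _ (w./2 - 3 * k - 3)%N _ s5))
  (E _ (2 * k).+1 _ s6).
rewrite /basis_poly /basis_cofactor => H; apply: leq_trans H _; lia.
Qed.


Definition basis_mx : 'M[rat]_(w %/ 6, w.+1) := \matrix_(k, i) (basis_poly k)`_i.

Lemma hform_basis k x y : y != 0 -> hform (row k basis_mx) x y = basis_fun k x y.
Proof.
move=> y0; have hk := ltn_ord k.
transitivity (y ^+ w * (basis_poly k).[x / y]).
  rewrite (horner_coef_wide _ (size_basis_poly hk)) mulr_sumr; apply: eq_bigr => i _.
  have -> : y ^+ w = y ^+ i * y ^+ (w - i) by rewrite -exprD subnKC ?leq_ord.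
  rewrite !mxE expr_div_n.
  by field; rewrite expf_neq0.
(* The degree w is shared among the three linear factors, the cubic factor and the quadratic
   factor. *)
have -> : y ^+ w = y ^+ 3 * (y ^+ 3) ^+ (2 * k).+1 * (y ^+ 2) ^+ (w./2 - 3 * k - 3).
  by rewrite -!exprM -!exprD; congr (_ ^+ _); lia.
rewrite /basis_poly /basis_cofactor /basis_fun !hornerM !horner_exp !hornerD !hornerN !hornerM.
rewrite !hornerX !hornerC.
have -> : x * y * (x + y) = y ^+ 3 * ((x / y) * (x / y + 1)) by field.
have -> : x ^+ 2 + x * y + y ^+ 2 = y ^+ 2 * (x / y * (x / y) + x / y + 1) by field.
rewrite [(y ^+ 3 * _) ^+ _]exprMn [(x / y * (x / y + 1)) ^+ _]exprMn [(y ^+ 2 * _) ^+ _]exprMn.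
move: ((y ^+ 3) ^+ _) ((x / y + 1) ^+ _) ((x / y) ^+ _) ((y ^+ 2) ^+ _) ((_ + _ + 1) ^+ _) => A B C D E.
by field.
Qed.

Lemma basis_skew_inv k : skew_inv (row k basis_mx).
Proof.
apply: skew_inv_nat => n; rewrite !hform_basis ?oner_neq0 ?pnatr_eq0 //.
- rewrite /basis_fun; set x := n.+1%:R.
  have -> : 1 * x * (1 + x) = x * 1 * (x + 1) by ring.
  have -> : 1 ^+ 2 + 1 * x + x ^+ 2 = x ^+ 2 + x * 1 + 1 ^+ 2 by ring.
  ring.
- rewrite /basis_fun; set x := n.+1%:R.
  have -> : 1 * (- x - 1) * (1 + (- x - 1)) = x * 1 * (x + 1) by ring.
  have -> : 1 ^+ 2 + 1 * (- x - 1) + (- x - 1) ^+ 2 = x ^+ 2 + x * 1 + 1 ^+ 2 by ring.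
  ring.
- by rewrite -opprD oppr_eq0 natr1 pnatr_eq0.
Qed.

(** The k-th basis polynomial starts at X^(2k+1), so its odd coefficients form a triangular matrix
    whose diagonal consists of the nonzero constant terms of the cofactors. *)
Lemma basis_free : row_free basis_mx.
Proof.
have T k l : (basis_mx *m odd_coefs) k l =
    if (l < k)%N then 0 else (basis_cofactor k)`_(2 * l - 2 * k).
  transitivity ((row k basis_mx *m odd_coefs) ord0 l); first by rewrite -row_mul [RHS]mxE.
  have hl : ((2 * l).+1 < w.+1)%N by have := ltn_ord l; lia.
  rewrite mul_odd_coefs (coef_dehom _ (Ordinal hl)) !mxE /basis_poly coefMXn /=.
  rewrite subSS ltnS (_ : (2 * l < 2 * k)%N = (l < k)%N) // ltn_pmul2l //.
suff : basis_mx *m odd_coefs \in unitmx.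
  by rewrite -row_free_unit => /row_freeP[B hB]; apply/row_freeP; exists (odd_coefs *m B); rewrite mulmxA.
rewrite unitmxE -det_tr det_trig; last by apply/is_trig_mxP => l k lk; rewrite mxE T lk.
rewrite unitfE; apply/prodf_neq0 => k _; rewrite mxE T ltnn subnn -horner_coef0.
rewrite /basis_cofactor !hornerM !horner_exp !hornerD !hornerN !hornerM !hornerX !hornerC.
by rewrite !mulr0 !add0r !expr1n.
Qed.

(** Gram matrix of a pairing for which the monomials are orthogonal; it turns the lower bound on the
    rank of [even_skew *m Pmx] into an orthogonality question. *)
Definition alt_cols : 'M[rat]_w.+1 :=
  diag_mx (\row_(i < w.+1) ((-1) ^+ i / 'C(w, i)%:R)).

(* The invariant pairing on forms, twisted by x -> - x, makes [Umx] self-adjoint. *)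
Lemma alt_cols_Umx : alt_cols *m (Umx w)^T = Umx w *m alt_cols.
Proof.
apply/matrixP => i j; rewrite mul_diag_mx mul_mx_diag !mxE.
have hi := leq_ord i; have hj := leq_ord j.
case: (leqP (i + j)%N w) => hij; last by rewrite (@bin_small (w - j)) ?(@bin_small (w - i)) ?mulr0 ?mul0r //; lia.
have Ci : 'C(w, i)%:R != 0 :> rat by rewrite pnatr_eq0 -lt0n bin_gt0.
have Cj : 'C(w, j)%:R != 0 :> rat by rewrite pnatr_eq0 -lt0n bin_gt0.
(* Both sides are the multinomial coefficient of i, j and w - i - j. *)
have key : ('C(w, i) * 'C(w - i, j) = 'C(w, j) * 'C(w - j, i))%N.
  have F n m : (m <= n)%N -> ('C(n, m) * (m`! * (n - m)`!) = n`!)%N by apply: bin_fact.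
  have e1 := F w i hi; have e2 := F w j hj; have e3 := F (w - i)%N j; have e4 := F (w - j)%N i.
  apply/eqP; rewrite -(eqn_pmul2r (m := i`! * j`! * (w - i - j)`!)) ?muln_gt0 ?fact_gt0 //; apply/eqP.
  have -> : ('C(w, i) * 'C(w - i, j) * (i`! * j`! * (w - i - j)`!) = w`!)%N.
    by rewrite -e1 -e3; [ring | lia].
  have -> : (w - i - j = w - j - i)%N by lia.
  by rewrite -e2 -e4; [ring | lia].
move/(congr1 (fun n : nat => n%:R : rat)): key; rewrite !natrM => key.
have s : (-1) ^+ i * (-1) ^+ (w - j) = (-1) ^+ (w - i) * (-1) ^+ j :> rat.
  by rewrite -!exprD -signr_odd -[RHS]signr_odd; congr (_ ^+ nat_of_bool _); lia.
apply: (mulfI Ci); apply: (mulfI Cj).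
transitivity (((-1) ^+ i * (-1) ^+ (w - j)) * ('C(w, j)%:R * 'C(w - j, i)%:R) : rat).
  by field.
by rewrite s -key; field.
Qed.

Definition Pmx : 'M[rat]_w.+1 := 1%:M + Umx w + Umx w *m Umx w.

Lemma alt_cols_Pmx : alt_cols *m Pmx^T = Pmx *m alt_cols.
Proof.
have -> : Pmx^T = 1%:M + (Umx w)^T + (Umx w)^T *m (Umx w)^T.
  by rewrite /Pmx !linearD /= trmx1 trmx_mul.
rewrite /Pmx !mulmxDr !mulmxDl mulmx1 mul1mx alt_cols_Umx.
by rewrite mulmxA alt_cols_Umx -!mulmxA alt_cols_Umx.
Qed.

Lemma hform_Pmx u x y :
  hform (u *m Pmx) x y = hform u x y + hform u y (- x - y) + hform u (- x - y) x.
Proof.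
rewrite /Pmx !mulmxDr mulmx1 !hformD mulmxA !hform_U //; congr (_ + hform _ _ _); ring.
Qed.

Lemma skew_Pmx u : (forall x y, hform u y x = - hform u x y) -> skew_inv (u *m Pmx).
Proof.
move=> h; split=> x y; rewrite !hform_Pmx.
  have -> : - y - x = - x - y by ring.
  by rewrite (h x y) (h (- x - y) x) (h y (- x - y)); ring.
have -> : - y - (- x - y) = x by ring.
ring.
Qed.

(** The rows are x^e y^(w-e) - x^(w-e) y^e for the even exponents e with 0 < e < w/2, of which there
    are [(w - 1) %/ 4]. *)
Definition even_skew : 'M[rat]_((w - 1) %/ 4, w.+1) :=
  \matrix_(l, i) ((i == (2 * l).+2 :> nat)%:R - (i == w - (2 * l).+2 :> nat)%N%:R).

Lemma even_skew_rev (y : 'rV_((w - 1) %/ 4)) : let u := y *m even_skew in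
  forall i : 'I_w.+1, u ord0 (rev_ord i) = - u ord0 i.
Proof.
move=> u i; rewrite !mxE -sumrN; apply: eq_bigr => l _; rewrite !mxE -mulrN opprB; congr (_ * (_%:R - _%:R)).
  by congr (nat_of_bool _); apply/eqP/eqP => /=; have := ltn_ord l; have := ltn_ord i; lia.
by congr (nat_of_bool _); apply/eqP/eqP => /=; have := ltn_ord l; have := ltn_ord i; lia.
Qed.

Lemma even_skew_hform (y : 'rV_((w - 1) %/ 4)) x1 x2 : hform (y *m even_skew) x2 x1 = - hform (y *m even_skew) x1 x2.
Proof.
rewrite -hform_rev -hformN; congr (hform _ _ _); apply/rowP => i.
by rewrite mxE even_skew_rev [RHS]mxE.
Qed.

(** Skewness carries the coefficients below the middle to those above it, and makes the middle one
    its own negative. *)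
Lemma skew_even_coefs u : (forall i, u ord0 (rev_ord i) = - u ord0 i) ->
  (forall i : 'I_w.+1, i = 0%N :> nat -> u ord0 i = 0) ->
  (forall (l : 'I_((w - 1) %/ 4)) (i : 'I_w.+1), i = (2 * l).+2 :> nat -> u ord0 i = 0) ->
  forall i : 'I_w.+1, ~~ odd i -> u ord0 i = 0.
Proof.
move=> skew u0 u_low i oi.
have half (k : 'I_w.+1) : ~~ odd k -> (2 * k < w)%N -> u ord0 k = 0.
  move=> ok hk; case: (posnP k) => [|k0]; first exact: u0.
  have hl : (k./2 - 1 < (w - 1) %/ 4)%N by lia.
  by apply: (u_low (Ordinal hl)) => /=; lia.
case: (ltngtP (2 * i)%N w) => hi; first exact: half.
  by have := skew (rev_ord i); rewrite rev_ordK (half (rev_ord i)) ?oppr0 //=; have := ltn_ord i; lia.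
have := skew i; rewrite (_ : rev_ord i = i); first by lra.
by apply/val_inj => /=; have := ltn_ord i; lia.
Qed.

Lemma even_skew_span u : (forall i, u ord0 (rev_ord i) = - u ord0 i) ->
  (forall i : 'I_w.+1, odd i || (i == 0%N :> nat) -> u ord0 i = 0) ->
  exists y, u = y *m even_skew.
Proof.
move=> skew u0; pose y : 'rV_((w - 1) %/ 4) := \row_l u ord0 (inord (2 * l).+2).
have ev (i : 'I_w.+1) : (y *m even_skew) ord0 i =
    \sum_l y ord0 l * ((i == (2 * l).+2 :> nat)%:R - (i == w - (2 * l).+2 :> nat)%N%:R).
  by rewrite mxE; apply: eq_bigr => l _; rewrite [even_skew _ _]mxE.
exists y; apply/eqP; rewrite -subr_eq0; apply/eqP/rowP => i; rewrite [RHS]mxE.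
have D k : (u - y *m even_skew) ord0 k = u ord0 k - (y *m even_skew) ord0 k.
  by rewrite mxE [X in _ + X]mxE.
have z (k : 'I_w.+1) : odd k || (k == 0%N :> nat) -> (u - y *m even_skew) ord0 k = 0.
  move=> hk; rewrite D u0 // ev big1 ?subrr // => l _; have hl := ltn_ord l.
  rewrite (_ : (k == (2 * l).+2 :> nat) = false); last by apply/eqP; lia.
  by rewrite (_ : (k == w - (2 * l).+2 :> nat)%N = false) ?subrr ?mulr0 //; apply/eqP; lia.
case: (boolP (odd i)) => oi; first by rewrite z ?oi.
apply: skew_even_coefs oi => [k|k k0|l k kl].
- by rewrite !D skew even_skew_rev; ring.
- by rewrite z // k0 orbT.
have hl := ltn_ord l; rewrite D ev (bigD1 l) //= kl eqxx.
rewrite (_ : ((2 * l).+2 == w - (2 * l).+2)%N = false); last by apply/eqP; lia.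
rewrite big1 => [|l' ll]; last first.
  have hl' := ltn_ord l'.
  rewrite (_ : ((2 * l).+2 == (2 * l').+2)%N = false); last by apply: contraNF ll => /eqP e; apply/eqP/val_inj => /=; lia.
  by rewrite (_ : ((2 * l).+2 == w - (2 * l').+2)%N = false) ?subrr ?mulr0 //; apply/eqP; lia.
by rewrite addr0 mxE -kl inord_val subr0 mulr1 subrr.
Qed.

(** The image consists of skew-invariant forms, whence the upper bound. For the lower bound, the
    pairing of the [w %/ 6] basis forms with the image is shown to be nondegenerate on the basis
    side. *)
Lemma rank_even_skew_Pmx : \rank (even_skew *m Pmx) = (w %/ 6)%N.
Proof.
apply/eqP; rewrite eqn_leq; apply/andP; split.
  apply: skew_inv_rank => i; rewrite row_mul; apply: skew_Pmx => x y.
  by rewrite rowE even_skew_hform.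
rewrite -mxrank_tr trmx_mul.
apply: leq_trans (mxrankM_maxr (basis_mx *m alt_cols) _).
suff /eqP -> : row_free (basis_mx *m alt_cols *m (Pmx^T *m even_skew^T)) by [].
rewrite -kermx_eq0; apply/rowV0P => y /sub_kermxP.
have [b eb] : {b | b = y *m basis_mx} by exists (y *m basis_mx).
rewrite !mulmxA -eb => hb.
have sb : skew_inv b by rewrite eb; apply: skew_inv_comb => k; apply: basis_skew_inv.
(* [Pmx] is self-adjoint and acts on the invariant form [b] as 3, so [b] itself is orthogonal to all
   of [even_skew]. *)
have bP : b *m Pmx = 3 *: b.
  rewrite /Pmx !mulmxDr mulmx1 mulmxA !(skew_inv_mulU sb).
  by rewrite -[3]/(1 + 1 + 1 : rat) !scalerDl !scale1r.
rewrite -(mulmxA b) alt_cols_Pmx mulmxA bP -!scalemxAl in hb.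
have {}hb : b *m alt_cols *m even_skew^T = 0.
  by apply/eqP; move/eqP: hb; rewrite scaler_eq0 => /orP[/eqP|].
(* Pairing with row [l] involves only the coefficients at 2l + 2 and w - 2l - 2. By skewness their
   contributions agree, giving twice a nonzero multiple of [b ord0 i]. *)
have b_low (l : 'I_((w - 1) %/ 4)) (i : 'I_w.+1) : i = (2 * l).+2 :> nat -> b ord0 i = 0.
  move=> il; have hl := ltn_ord l; have hi := ltn_ord i.
  move/rowP/(_ l): hb; rewrite mul_mx_diag !mxE.
  rewrite (bigD1 i) //= (bigD1 (rev_ord i)) /=; last first.
    by apply/eqP => /(congr1 val) /=; lia.
  rewrite !mxE /= big1 => [|k /andP[k1 k2]]; last first.
    rewrite !mxE /=; case: eqP => [e|_]; first by case/eqP: k1; apply/val_inj; rewrite /= e il.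
    case: eqP => [e|_]; last by rewrite subr0 mulr0.
    by case/eqP: k2; apply/val_inj; rewrite /= e; lia.
  rewrite skew_inv_rev // subSS bin_sub; last by lia.
  rewrite il eqxx (_ : ((2 * l).+2 == w - (2 * l).+2)%N = false); last by apply/eqP; lia.
  rewrite (_ : (w - (2 * l).+2 == (2 * l).+2)%N = false); last by apply/eqP; lia.
  rewrite eqxx (_ : (-1) ^+ (2 * l).+2 = 1); last by rewrite -signr_odd (_ : odd _ = false) //; lia.
  rewrite (_ : (-1) ^+ (w - (2 * l).+2) = 1); last by rewrite -signr_odd (_ : odd _ = false) //; lia.
  move=> /eqP; have C0 : 'C(w, (2 * l).+2)%:R != 0 :> rat by rewrite pnatr_eq0 -lt0n bin_gt0; lia.
  rewrite (_ : _ + _ = 2 * (b ord0 i / 'C(w, (2 * l).+2)%:R)); last by rewrite /=; ring.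
  by rewrite !mulf_eq0 invr_eq0 (negbTE C0) orbF /= => /eqP.
have b_even := skew_even_coefs (skew_inv_rev sb) _ b_low.
(* All even coefficients vanish, the constant one by [skew_inv_coef_even], so [b] is odd in x. *)
have b0 : b = 0.
  apply: skew_inv_alt_eq0 => // x1 x2; rewrite -hform_alt -hformN; congr (hform _ _ _).
  apply/rowP => i; rewrite !mxE; case oi: (odd i).
    by rewrite -signr_odd oi expr1 mulN1r.
  rewrite b_even ?oi ?mulr0 ?oppr0 // => k k0.
  by rewrite -coef_dehom; apply: skew_inv_coef_even; rewrite // k0.
by apply/eqP; rewrite -(mulmx_free_eq0 y basis_free) -eb b0.
Qed.

End Rank.

(** * The dimension of W_{N,2} *)

Definition geom46 : series := mulS (geomS 4) (geomS 6).

(** Coefficientwise, multiplying by 1 - x^4 leaves 1/(1 - x^6). *)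
Lemma geom46_rec m : geom46 (m + 4)%N = geom46 m + (6 %| m + 4)%N%:R.
Proof.
rewrite /geom46 /mulS (_ : (m + 4).+1 = (m.+1).+4)%N; last by lia.
do 4!rewrite [in LHS]big_ord_recl; rewrite /geomS /= subn0 mul1r !mul0r !add0r addrC; congr (_ + _).
apply: eq_bigr => i _; rewrite /bump /= !add1n.
have -> : (4 %| i.+4 = (4 %| i))%N by rewrite -[i.+4]addn4 dvdn_addl.
by have -> : (m + 4 - i.+4 = m - i)%N by lia.
Qed.

Lemma geom46_even h : geom46 (2 * h)%N = ((2 * h + 12) %/ 4 - 1 - (2 * h + 10) %/ 6)%N%:R.
Proof.
elim/ltn_ind: h => [[|[|h]] IH].
- by rewrite /geom46 /mulS !big_ord_recl big_ord0.
- by rewrite /geom46 /mulS !big_ord_recl big_ord0.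
have -> : (2 * h.+2 = 2 * h + 4)%N by lia.
rewrite geom46_rec IH // -natrD; congr (_%:R).
case: (boolP (6 %| 2 * h + 4)%N) => [/dvdnP[k hk]|hk]; first by rewrite /=; lia.
rewrite /= addn0; move: hk; rewrite /dvdn => hk.
lia.
Qed.

Lemma geom46_odd h : geom46 (2 * h).+1%N = 0.
Proof.
rewrite /geom46 /mulS big1 // => i _; rewrite /geomS -natrM mulnb.
case: andP => // -[/dvdnP[a ha] /dvdnP[b hb]]; have := ltn_ord i; lia.
Qed.

Lemma SS_shift N : SS N = if (N < 12)%N then 0 else geom46 (N - 12)%N.
Proof.
rewrite /SS -/geom46 /mulS; case: ltnP => hN.
  rewrite big1 // => i _; rewrite /serX (_ : (nat_of_ord i == 12%N) = false) ?mul0r //.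
  by apply/eqP; have := ltn_ord i; lia.
have h : (12 < N.+1)%N by lia.
rewrite (bigD1 (Ordinal h)) //= /serX eqxx mul1r big1 ?addr0 // => i hi.
rewrite (_ : (nat_of_ord i == 12%N) = false) ?mul0r //.
by apply: contraNF hi => /eqP e; apply/eqP/val_inj.
Qed.

Lemma SS_odd N : odd N -> SS N = 0.
Proof.
move=> oN; rewrite SS_shift; case: ltnP => // hN.
have -> : (N - 12 = (2 * ((N - 13)./2)).+1)%N by lia.
exact: geom46_odd.
Qed.

(** With w = N - 2 this is the number of rows of [even_skew] minus the rank of 1 + U + U^2 on
    them. *)
Lemma SS_even N : ~~ odd N -> (4 <= N)%N -> SS N = ((N - 3) %/ 4 - (N - 2) %/ 6)%N%:R.
Proof.
move=> oN N4; rewrite SS_shift; case: ltnP => hN.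
  by rewrite (_ : (_ - _)%N = 0%N) //; lia.
have -> : (N - 12 = 2 * ((N - 12)./2))%N by lia.
by rewrite geom46_even; congr (_%:R); lia.
Qed.

Lemma kS2_eq0 N : odd N || (N < 4)%N -> kS N 2 = 0%N.
Proof.
move=> hN; apply/eqP; rewrite -leqn0 leqNgt; apply/negP => h.
have := Sidx_mem (Ordinal h); rewrite mem_Sseq.
case: (Sidx _) => [|a [|b [|c s]]] //= /andP[/eqP sm /and3P[h1 h2 _]]; lia.
Qed.

Lemma sum_Sidx N r s (F : seq nat -> rat) : s \in Sseq N r ->
  \sum_(q < kS N r) F (Sidx q) * (Sidx q == s)%:R = F s.
Proof.
move=> hs; have [q eq] := Sidx_surj hs; rewrite (bigD1 q) //= eq eqxx mulr1 big1 ?addr0 // => k kq.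
suff -> : (Sidx k == s) = false by rewrite mulr0.
by apply: contraNF kq; rewrite -eq => /eqP/Sidx_inj ->.
Qed.

Section DepthTwo.
Variable N : nat.
Hypothesis N_even : ~~ odd N.
Hypothesis N4 : (4 <= N)%N.
Let w := (N - 2)%N.
Let w_even : ~~ odd w. Proof. rewrite /w; lia. Qed.

(** Embeds V_{N,2} into the forms of degree w = N - 2, where U acts. *)
Definition to_form : 'M[rat]_(kS N 2, w.+1) :=
  \matrix_(q, i) (i == (head 0%N (Sidx q)).-1 :> nat)%:R.

Lemma Sidx2 (q : 'I_(kS N 2)) : exists a b, [/\ Sidx q = [:: a; b], (a + b = N)%N,
   odd a && (3 <= a)%N & odd b && (3 <= b)%N].
Proof.
move: (Sidx_mem q); rewrite mem_Sseq; case: (Sidx q) => [|a [|b [|c s]]] //= /andP[/eqP sm /and3P[h1 h2 _]].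
by exists a, b; split => //; lia.
Qed.

Lemma vpoly_to_form (v : 'rV[rat]_(kS N 2)) x y : vpoly v [:: x; y] = hform (v *m to_form) x y.
Proof.
rewrite /hform; under [RHS]eq_bigr => i _ do rewrite mxE mulr_suml.
rewrite exchange_big; apply: eq_bigr => q _ /=.
have [a [b [e s /andP[oa a3] /andP[ob b3]]]] := Sidx2 q.
have ha : (a.-1 < w.+1)%N by rewrite /w; lia.
rewrite (bigD1 (Ordinal ha)) //= big1 => [|i hi].
  rewrite mxE e /= eqxx mulr1 addr0 !monom_cons monom_nil mulr1; congr (_ * (_ * _ ^+ _)).
  by rewrite /w; lia.
rewrite mxE e /= (_ : (nat_of_ord i == a.-1) = false) ?mulr0 ?mul0r //.
by apply: contraNF hi => /eqP ei; apply/eqP/val_inj.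
Qed.

Lemma to_form_inj (v v' : 'rV[rat]_(kS N 2)) : v *m to_form = v' *m to_form -> v = v'.
Proof.
move=> h; apply: vpoly_inj => -[|x [|y [|z l]]] //= _.
by rewrite !vpoly_to_form h.
Qed.

Lemma to_form_odd (v : 'rV[rat]_(kS N 2)) (i : 'I_w.+1) : odd i || (i == 0%N :> nat) ->
  (v *m to_form) ord0 i = 0.
Proof.
move=> hi; rewrite mxE big1 // => q _; rewrite mxE.
have [a [b [-> s /andP[oa a3] /andP[ob b3]]]] := Sidx2 q.
by rewrite (_ : (_ == _) = false) ?mulr0 //=; apply/eqP; lia.
Qed.

Lemma inW_form (v : 'rV[rat]_(kS N 2)) : inW v <->
  (forall x y, hform (v *m to_form) y x = - hform (v *m to_form) x y) /\
  v *m to_form *m Pmx w = 0.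
Proof.
set u := v *m to_form.
have even1 x y : hform u (- x) y = hform u x y by rewrite -!vpoly_to_form vpoly_even.
have even2 x y : hform u x (- y) = hform u x y by rewrite -even1 hform_opp.
split=> [hv | [sk hP]].
  split=> [x y|]; first by rewrite -!vpoly_to_form inW_anti.
  apply: hform_inj => n; rewrite hform0 hform_Pmx //; set x := n.+1%:R; set y := 1.
  have /(@inWP N 2 v isT)/(_ x (- y) [::] erefl) := hv; rewrite !vpoly_to_form -/u !even2.
  have -> : - y - x = - x - y by ring.
  have := @inW_anti N 2 v (- x - y) y [::] isT hv erefl; rewrite !vpoly_to_form -/u; lra.
apply/(@inWP N 2 v isT) => x y [|z l] // _; rewrite !vpoly_to_form -/u.
have := hform_Pmx w_even u x (- y); rewrite hP hform0 opprK !even2.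
rewrite (_ : - x + y = y - x); last by ring.
rewrite -(even1 (- y)) opprK (sk y (y - x)); lra.
Qed.

(** Lifts [even_skew] to V_{N,2}; indices are exponents plus one, hence 2l + 3 and w - 2l - 1. *)
Definition skew_mx : 'M[rat]_((w - 1) %/ 4, kS N 2) :=
  \matrix_(l, q) ((Sidx q == [:: (2 * l).+3; (w - (2 * l).+1)%N])%:R
                - (Sidx q == [:: (w - (2 * l).+1)%N; (2 * l).+3])%:R).

Lemma skew_mx_to_form : skew_mx *m to_form = even_skew w.
Proof.
apply/matrixP => l i; rewrite !mxE; have hl := ltn_ord l.
under eq_bigr => q _ do rewrite !mxE mulrC mulrBr.
have F (s : seq nat) : s \in Sseq N 2 ->
    \sum_(q < kS N 2) (i == (head 0%N (Sidx q)).-1 :> nat)%:R * (Sidx q == s)%:R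
      = (i == (head 0%N s).-1 :> nat)%:R :> rat.
  exact: (sum_Sidx (fun s => (i == (head 0%N s).-1 :> nat)%:R)).
rewrite sumrB !F ?mem_Sseq /=; try by rewrite /w in hl *; lia.
by congr (_ - (nat_of_bool (_ == _))%:R); rewrite /=; lia.
Qed.

Lemma skew_mx_free : row_free skew_mx.
Proof.
pose B : 'M[rat]_(kS N 2, (w - 1) %/ 4) := \matrix_(q, l) (Sidx q == [:: (2 * l).+3; (w - (2 * l).+1)%N])%:R.
apply/row_freeP; exists B; apply/matrixP => l k; rewrite !mxE; have hl := ltn_ord l; have hk := ltn_ord k.
under eq_bigr => q _ do rewrite !mxE.
rewrite (sum_Sidx (fun s => (s == [:: (2 * l).+3; (w - (2 * l).+1)%N])%:R - (s == [:: (w - (2 * l).+1)%N; (2 * l).+3])%:R)).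
  rewrite !eqseq_cons !andbT -val_eqE /=.
  rewrite (_ : ((2 * k).+3 == w - (2 * l).+1)%N = false) ?subr0 /=; last by apply/eqP; lia.
  congr (nat_of_bool _)%:R; apply/andP/eqP => [[/eqP h1 _]|->]; last by rewrite !eqxx.
  lia.
rewrite mem_Sseq /=; rewrite /w in hk *; lia.
Qed.

(** W_{N,2} is the kernel of 1 + U + U^2 on even skew-symmetric forms, so rank-nullity gives its
    dimension. *)
Lemma exists_W2_basis_even : exists d (B : 'M[rat]_(d, kS N 2)),
  [/\ row_free B, SS N = d%:R & forall v : 'rV_(kS N 2), inW v <-> (v <= B)%MS].
Proof.
pose K := kermx (even_skew w *m Pmx w).
exists (\rank (K *m skew_mx)), (row_base (K *m skew_mx)); split.
- exact: row_base_free.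
- rewrite mxrankMfree ?skew_mx_free // mxrank_ker rank_even_skew_Pmx // SS_even //.
  by rewrite /w; congr ((_ %/ _ - _)%:R); lia.
move=> v; rewrite eq_row_base; split=> [/inW_form[sk hP]|/submxP[y ->]].
  have [y hy] : exists y, v *m to_form = y *m even_skew w.
    apply: even_skew_span => //; last exact: to_form_odd.
    move=> i; have : \row_i (v *m to_form) ord0 (rev_ord i) = - (v *m to_form).
      by apply: hform_inj => n; rewrite hform_rev sk hformN.
    by move/rowP/(_ i); rewrite mxE [RHS]mxE.
  have -> : v = y *m skew_mx by apply: to_form_inj; rewrite hy -mulmxA skew_mx_to_form.
  apply: submxMr; apply/sub_kermxP; rewrite mulmxA -hy; exact: hP.
have : K *m (even_skew w *m Pmx w) = 0 by apply: mulmx_ker.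
move: (K) => {}K KP; apply/inW_form; rewrite -!mulmxA !(mulmxA skew_mx) !skew_mx_to_form; split.
  by move=> x1 x2; rewrite mulmxA even_skew_hform.
by rewrite KP mulmx0.
Qed.

End DepthTwo.

Lemma exists_W2_basis N : exists d (B : 'M[rat]_(d, kS N 2)),
  [/\ row_free B, SS N = d%:R & forall v : 'rV_(kS N 2), inW v <-> (v <= B)%MS].
Proof.
case: (boolP (odd N || (N < 4)%N)) => [hN|]; last first.
  by rewrite negb_or -leqNgt => /andP[oN N4]; apply: exists_W2_basis_even.
have k0 := kS2_eq0 hN.
exists 0%N, 0; split.
- by rewrite -row_leq_rank.
- by case/orP: hN => [/SS_odd //|hN]; rewrite SS_shift (leq_trans hN).
move=> v; have v0 (u : 'rV[rat]_(kS N 2)) : u = 0 by apply/rowP => i; have := ltn_ord i; rewrite {2}k0.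
rewrite [v]v0 sub0mx; split=> // _; apply/(@inWP N 2 _ isT) => x y z _.
have z0 l : vpoly (0 : 'rV[rat]_(kS N 2)) l = 0 by rewrite /vpoly big1 // => i _; rewrite mxE mul0r.
by rewrite !z0 subrr.
Qed.

(** * Splitting off a prefix of the indices *)

(** [B t] recovers coordinates in block t and kills all other blocks. Hence the sum is direct, and
    each [A t] preserves ranks. *)
Lemma rank_sum_biorthogonal (F : fieldType) (T : finType) (K : nat) (d : T -> nat)
    (A : forall t, 'M[F]_(d t, K)) (B : forall t, 'M[F]_(K, d t)) (C : forall t, 'M[F]_(d t)) :
  (forall t, A t *m B t = 1%:M) -> (forall t t', t != t' -> A t *m B t' = 0) ->
  \rank (\sum_t <<C t *m A t>>)%MS = (\sum_t \rank (C t))%N.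
Proof.
move=> h1 h0.
have /mxdirectP /= -> : mxdirect (\sum_t <<C t *m A t>>).
  apply/mxdirect_sumsP => t _; apply/eqP/rowV0P => u; rewrite sub_capmx genmxE.
  case/andP => /submxP[x ux] us.
  have : (\sum_(j | j != t) <<C j *m A j>> <= kermx (B t))%MS.
    apply/sumsmx_subP => j jt; rewrite genmxE; apply/sub_kermxP.
    by rewrite -mulmxA h0 // mulmx0.
  move/(submx_trans us)/sub_kermxP; rewrite ux -!mulmxA h1 // mulmx1 => xC.
  by rewrite mulmxA xC mul0mx.
apply: eq_bigr => t _; rewrite genmxE mxrankMfree //.
by apply/row_freeP; exists (B t); apply: h1.
Qed.

(* The rows of [prefix_mx p] are the basis vectors indexed by the extensions of the prefix [p]. *)
Definition prefix_mx (N r k M : nat) (p : seq nat) : 'M[rat]_(kS M k, kS N r) :=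
  \matrix_(s, i) (Sidx i == p ++ Sidx s)%:R.

Section Prefix.
Variables (N r k M : nat).

Lemma prefix_mem p (s : 'I_(kS M k)) : p \in Sseq (N - M) (r - k) -> (M <= N)%N -> (k <= r)%N ->
  p ++ Sidx s \in Sseq N r.
Proof.
move=> hp MN kr; move: hp (Sidx_mem s); rewrite !mem_Sseq size_cat sumn_cat all_cat.
by case/and3P=> /eqP -> /eqP -> -> /and3P[/eqP -> /eqP -> ->]; rewrite andbT !subnK // !eqxx.
Qed.

Lemma prefix_mx_tr p : p \in Sseq (N - M) (r - k) -> (M <= N)%N -> (k <= r)%N ->
  prefix_mx N r k M p *m (prefix_mx N r k M p)^T = 1%:M.
Proof.
move=> hp MN kr; apply/matrixP => s s'; rewrite !mxE.
under eq_bigr => i _ do rewrite !mxE.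
rewrite (sum_Sidx (fun e => (e == p ++ Sidx s)%:R) (prefix_mem s' hp MN kr)).
by rewrite eqseq_cat // eqxx /= (inj_eq (@Sidx_inj _ _)) eq_sym.
Qed.

Lemma prefix_mx_tr0 M' p p' : size p = size p' -> p != p' ->
  prefix_mx N r k M p *m (prefix_mx N r k M' p')^T = 0.
Proof.
move=> sz pp; apply/matrixP => s s'; rewrite !mxE big1 // => i _; rewrite !mxE -natrM mulnb.
case: andP => // -[/eqP -> ]; by rewrite eqseq_cat // (negbTE pp).
Qed.

(** For [j <= k] the matrix E^(j) changes only the last j indices, so it leaves the prefix alone. *)
Lemma prefix_mx_Ej p j : p \in Sseq (N - M) (r - k) -> (M <= N)%N -> (k <= r)%N -> (j <= k)%N ->
  prefix_mx N r k M p *m Ejmx N r j = Ejmx M k j *m prefix_mx N r k M p.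
Proof.
move=> hp MN kr jk; apply/matrixP => s i; rewrite !mxE.
have szp : size p = (r - k)%N by move: hp; rewrite mem_Sseq => /and3P[/eqP].
have rj : (r - j = size p + (k - j))%N by lia.
under eq_bigr => i' _ do rewrite !mxE mulrC.
rewrite (sum_Sidx (fun e => (take (r - j) e == take (r - j) (Sidx i))%:R
  * ecoef (drop (r - j) e) (drop (r - j) (Sidx i))) (prefix_mem s hp MN kr)).
rewrite rj; set m := (k - j)%N; set e := Sidx i.
have TD (l : seq nat) : take (size p + m) l = take (size p) l ++ take m (drop (size p) l) by rewrite takeD.
have DD (l : seq nat) : drop (size p + m) l = drop m (drop (size p) l) by rewrite drop_drop addnC.
rewrite !TD !DD take_size_cat // drop_size_cat //.
have szt : size p = size (take (size p) e) by rewrite size_takel // Sidx_size szp leq_subr.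
rewrite eqseq_cat //.
have E s' : (e == p ++ Sidx s') = (p == take (size p) e) && (Sidx s' == drop (size p) e).
  rewrite -{1}(cat_take_drop (size p) e) eqseq_cat -?szt //.
  by rewrite (eq_sym p) (eq_sym (Sidx s')).
under eq_bigr => s' _ do rewrite !mxE -/e E.
case: (altP (p =P take (size p) e)) => [ep|np] /=; last first.
  by rewrite mul0r big1 // => s' _; rewrite mulr0.
have hs : drop (size p) e \in Sseq M k.
  move: (Sidx_mem i) hp; rewrite -/e !mem_Sseq -{1 2 3}(cat_take_drop (size p) e) -ep.
  rewrite size_cat sumn_cat all_cat => /and3P[/eqP h1 /eqP h2 /andP[_ ->]] /and3P[/eqP h3 /eqP h4 _].
  by rewrite andbT; apply/andP; split; apply/eqP; lia.
rewrite -[LHS](sum_Sidx (fun l => (take m (Sidx s) == take m l)%:R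
  * ecoef (drop m (Sidx s)) (drop m l)) hs).
by apply: eq_bigr => s' _; rewrite -/m.
Qed.
End Prefix.

(* The product E^(2) ... E^(m+1). *)
Definition Eprod (N r m : nat) : 'M[rat]_(kS N r) :=
  foldr (fun j M => Ejmx N r j *m M) 1%:M (iota 2 m).

Lemma Eprod_rcons N r m : Eprod N r m.+1 = Eprod N r m *m Ejmx N r m.+2.
Proof.
have H X s : foldr (fun j M => Ejmx N r j *m M) X s =
    foldr (fun j M => Ejmx N r j *m M) 1%:M s *m X.
  by elim: s => [|j s IH] /=; [rewrite mul1mx | rewrite IH mulmxA].
by rewrite /Eprod -[X in iota 2 X]addn1 iotaD foldr_cat H /= mulmx1.
Qed.

Lemma CmxE N r : Cmx N r = Eprod N r (r - 1).
Proof. by []. Qed.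

Lemma EmxE N r : Ejmx N r r = Emx N r.
Proof. by apply/matrixP => i k; rewrite !mxE subnn !take0 !drop0 eqxx mul1r. Qed.

Lemma phicompE N r (v : 'rV[rat]_(kS N r)) : (2 <= r)%N -> phicomp v = v *m Eprod N r (r - 2).
Proof.
move=> r2; rewrite /phicomp.
suff H m : (m.+1 <= r)%N -> foldl (fun w j => phi j w) v (iota 2 m) = v *m Eprod N r m by apply: H; lia.
elim: m => [|m IH] hm; first by rewrite /Eprod /= mulmx1.
by rewrite -[X in iota 2 X]addn1 iotaD foldl_cat /= IH ?(ltnW hm) // phi_mulmx ?Eprod_rcons ?mulmxA.
Qed.

Lemma prefix_mx_Eprod N r k M p m : p \in Sseq (N - M) (r - k) -> (M <= N)%N -> (k <= r)%N ->
  (m.+1 <= k)%N || (m == 0%N) ->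
  prefix_mx N r k M p *m Eprod N r m = Eprod M k m *m prefix_mx N r k M p.
Proof.
move=> hp MN kr; elim: m => [|m IH] hm; first by rewrite mulmx1 mul1mx.
rewrite !Eprod_rcons mulmxA IH; last by case: m hm {IH} => //= m; rewrite ?orbT ?orbF //; lia.
by rewrite -!mulmxA prefix_mx_Ej //; lia.
Qed.

(** Rank-nullity. The formula also covers r = 1, where [Cmx] is an empty product, and N = 0, where
    there are no indices. *)
Lemma TserE r N : (0 < r)%N -> Tser r N = (kS N r)%:R - (\rank (Cmx N r))%:R.
Proof.
move=> r0; rewrite /Tser; case: ifP => [/orP[r1|/eqP ->]|_].
- have -> : r = 1%N by lia.
  by rewrite CmxE subnn mxrank1 subrr.
- have h : \rank (Cmx 0 r) = 0%N.
    by apply/eqP; rewrite -leqn0; apply: leq_trans (rank_leq_row _) _; rewrite kS0.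
  by rewrite h kS0 ?subrr.
by rewrite mxrank_ker mxrank_tr natrB // rank_leq_row.
Qed.

(** * Subspaces of the form sum over n of X_n (x) Vect_{N-n,r-l} *)

Section Tensor.
Variables (N r l : nat).
Hypothesis lr : (l <= r)%N.
Variables (d : 'I_N.+1 -> nat) (X : forall n : 'I_N.+1, 'M[rat]_(d n, kS n l))
  (Y : forall n : 'I_N.+1, 'M[rat]_(kS n l, d n)).
Hypothesis XY : forall n, X n *m Y n = 1%:M.

Let pre (n : 'I_N.+1) (q : 'I_(kS n l)) : 'M[rat]_(kS (N - n) (r - l), kS N r) :=
  prefix_mx N r (r - l) (N - n) (Sidx q).

(* The vectors [(row j of X n) (x) e_s], as rows indexed by [s]. *)
Definition tens (t : {n : 'I_N.+1 & 'I_(d n)}) : 'M[rat]_(kS (N - tag t) (r - l), kS N r) :=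
  \sum_q X (tag t) (tagged t) q *: pre q.

Definition tens_dual (t : {n : 'I_N.+1 & 'I_(d n)}) : 'M[rat]_(kS N r, kS (N - tag t) (r - l)) :=
  \sum_q Y (tag t) q (tagged t) *: (pre q)^T.

Let pre_mem (n : 'I_N.+1) (q : 'I_(kS n l)) : Sidx q \in Sseq (N - (N - n)) (r - (r - l)).
Proof. by rewrite subKn ?leq_ord // subKn //; apply: Sidx_mem. Qed.

Lemma tens_dual_same (n : 'I_N.+1) (j j' : 'I_(d n)) :
  tens (Tagged (fun n => 'I_(d n)) j) *m tens_dual (Tagged (fun n => 'I_(d n)) j') = (j == j')%:R%:M.
Proof.
rewrite /tens /tens_dual /= mulmx_suml.
transitivity (\sum_q (X n j q * Y n q j')%:M : 'M[rat]_(kS (N - n) (r - l))).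
  apply: eq_bigr => q _; rewrite mulmx_sumr (bigD1 q) //= big1 => [|q' qq].
    rewrite addr0 -scalemxAl -scalemxAr prefix_mx_tr ?leq_subr //.
    by rewrite scalerA scalemx1.
  rewrite -scalemxAl -scalemxAr prefix_mx_tr0 ?scaler0 ?Sidx_size //.
  by apply: contra qq => /eqP/Sidx_inj ->.
rewrite -raddf_sum /=; congr (_%:M).
by have /matrixP/(_ j j') := XY n; rewrite !mxE.
Qed.

Lemma tens_dual1 t : tens t *m tens_dual t = 1%:M.
Proof. by case: t => n j; rewrite tens_dual_same eqxx. Qed.

Lemma tens_dual0 t t' : t != t' -> tens t *m tens_dual t' = 0.
Proof.
case: t t' => [n j] [n' j'].
case: (eqVneq n n') j' => [<- j' tt|nn j' _].
  rewrite tens_dual_same (_ : (j == j') = false) ?raddf0 //.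
  by apply: contraNF tt => /eqP ->.
rewrite /tens /tens_dual /= mulmx_suml big1 // => q _; rewrite mulmx_sumr big1 // => q' _.
rewrite -scalemxAl -scalemxAr prefix_mx_tr0 ?scaler0 ?Sidx_size //.
by apply: contra nn => /eqP/(congr1 sumn); rewrite !Sidx_sumn => /val_inj ->.
Qed.

Lemma tens_Eprod t m : (m < r - l)%N || (m == 0%N) ->
  tens t *m Eprod N r m = Eprod (N - tag t) (r - l) m *m tens t.
Proof.
move=> hm; rewrite /tens mulmx_suml mulmx_sumr; apply: eq_bigr => q _.
by rewrite -scalemxAl -scalemxAr prefix_mx_Eprod ?leq_subr.
Qed.

Lemma rank_tens m :
  \rank (\sum_(t : {n : 'I_N.+1 & 'I_(d n)}) <<Eprod (N - tag t) (r - l) m *m tens t>>)%MS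
  = (\sum_(n < N.+1) d n * \rank (Eprod (N - n) (r - l) m))%N.
Proof.
rewrite (rank_sum_biorthogonal _ tens_dual1 tens_dual0).
rewrite -(sig_big_dep xpredT (fun _ => xpredT) (fun n (j : 'I_(d n)) => \rank (Eprod (N - n) (r - l) m))) /=.
by apply: eq_bigr => n _; rewrite sum_nat_const card_ord.
Qed.

Lemma rank_tens_Eprod m : (m < r - l)%N || (m == 0%N) ->
  \rank ((\sum_(t : {n : 'I_N.+1 & 'I_(d n)}) <<tens t>>)%MS *m Eprod N r m)
  = (\sum_(n < N.+1) d n * \rank (Eprod (N - n) (r - l) m))%N.
Proof.
move=> hm; rewrite -rank_tens (sumsmxMr xpredT).
have e t : (<<tens t>>%MS *m Eprod N r m :=: <<Eprod (N - tag t) (r - l) m *m tens t>>)%MS.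
  rewrite -tens_Eprod //.
  exact: eqmx_trans (eqmxMr _ (genmxE _)) (eqmx_sym (genmxE _)).
by rewrite (eqmx_sums (fun t _ => e t)).
Qed.

(** Each index splits in exactly one way into its first l entries, of some weight n, and the
    rest. *)
Lemma prefix_partition : \sum_(n < N.+1) \sum_(q < kS n l) (pre q)^T *m pre q = 1%:M.
Proof.
apply/matrixP => i i'; rewrite summxE.
under eq_bigr => n _ do rewrite summxE.
under eq_bigr => n _ do under eq_bigr => q _ do rewrite mxE.
under eq_bigr => n _ do under eq_bigr => q _ do under eq_bigr => s _ do rewrite !mxE.
rewrite mxE; case: (eqVneq i i') => [<-|ii]; last first.
  rewrite big1 // => n _; rewrite big1 // => q _; rewrite big1 // => s _.
  rewrite -natrM mulnb; case: andP => // -[/eqP e1 /eqP e2].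
  by case/eqP: ii; apply: Sidx_inj; rewrite e1 e2.
set e := Sidx i.
have sz1 : size (take l e) = l by rewrite size_takel // Sidx_size.
have : e \in Sseq N r by apply: Sidx_mem.
rewrite mem_Sseq -{1 2 3}(cat_take_drop l e) size_cat sumn_cat all_cat.
case/and3P => /eqP szE /eqP smE /andP[al1 al2].
have hn : (sumn (take l e) < N.+1)%N by rewrite ltnS -smE leq_addr.
have h1 : take l e \in Sseq (sumn (take l e)) l by rewrite mem_Sseq sz1 !eqxx al1.
have h2 : drop l e \in Sseq (N - sumn (take l e)) (r - l).
  by rewrite mem_Sseq al2 andbT size_drop Sidx_size eqxx /= -smE addKn.
have E n (q : 'I_(kS n l)) M (s : 'I_(kS M (r - l))) : (e == Sidx q ++ Sidx s)%:R * (e == Sidx q ++ Sidx s)%:R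
   = (Sidx q == take l e)%:R * (Sidx s == drop l e)%:R :> rat.
  rewrite -{1 2}(cat_take_drop l e) eqseq_cat ?sz1 ?Sidx_size // (eq_sym (take l e)) (eq_sym (drop l e)).
  by case: (_ == _); case: (_ == _); rewrite ?mulr0 ?mul0r ?mulr1.
rewrite (bigD1 (Ordinal hn)) //= [X in _ + X]big1 => [|n nh].
  under eq_bigr => q _ do under eq_bigr => s _ do rewrite E -[(Sidx s == _)%:R]mul1r.
  under eq_bigr => q _ do rewrite -mulr_sumr (sum_Sidx (fun _ => 1) h2) mulr1 -[(_ == _)%:R]mul1r.
  by rewrite (sum_Sidx (fun _ => 1) h1) addr0.
rewrite big1 // => q _; rewrite big1 // => s _; rewrite E (_ : (Sidx q == take l e) = false) ?mul0r //.
apply: contraNF nh => /eqP eq; apply/eqP/val_inj => /=.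
by rewrite -eq Sidx_sumn.
Qed.

(** The coefficients of [v] at a fixed tail [s], as a vector in the first [l] indices of weight
    [n]. *)
Definition slice (v : 'rV[rat]_(kS N r)) (n : 'I_N.+1) (s : 'I_(kS (N - n) (r - l))) : 'rV[rat]_(kS n l) :=
  \row_q (v *m (pre q)^T) ord0 s.

Lemma sub_tens (v : 'rV[rat]_(kS N r)) :
  (forall n s, (slice v s <= X n)%MS) -> (v <= \sum_(t : {n : 'I_N.+1 & 'I_(d n)}) <<tens t>>)%MS.
Proof.
move=> h; rewrite -[v]mulmx1 -prefix_partition mulmx_sumr.
apply: summx_sub => n _; rewrite mulmx_sumr.
(* [y j] collects, over all tails, the j-th coordinate of the slices in the rows of [X n]. *)
pose y (j : 'I_(d n)) : 'rV[rat]_(kS (N - n) (r - l)) := \row_s (slice v s *m Y n) ord0 j.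
have -> : \sum_(q < kS n l) v *m ((pre q)^T *m pre q) =
    \sum_j y j *m tens (Tagged (fun n => 'I_(d n)) j).
  rewrite /tens /=; under [RHS]eq_bigr => j _ do rewrite mulmx_sumr.
  rewrite exchange_big; apply: eq_bigr => q _ /=; rewrite mulmxA.
  under eq_bigr => j _ do rewrite -scalemxAr scalemxAl.
  rewrite -mulmx_suml; congr (_ *m _); apply/rowP => s.
  have /submxP[z hz] := h n s.
  transitivity ((slice v s *m Y n *m X n) ord0 q).
    by rewrite hz -(mulmxA z) XY mulmx1 -hz [RHS]mxE.
  rewrite mxE summxE; apply: eq_bigr => j _; rewrite [RHS]mxE [y j _ _]mxE.
  by rewrite mulrC.
apply: summx_sub => j _; apply: submx_trans (submxMl _ _) _.
by rewrite (sumsmx_sup (Tagged (fun n => 'I_(d n)) j)) // genmxE.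
Qed.

End Tensor.

(** * The space W_{N,r} and the recursion *)

Lemma vpoly_lin N r a (v v' : 'rV[rat]_(kS N r)) z :
  vpoly (a *: v + v') z = a * vpoly v z + vpoly v' z.
Proof.
by rewrite /vpoly mulr_sumr -big_split; apply: eq_bigr => i _; rewrite /= !mxE; ring.
Qed.

Lemma vpoly0 N r z : vpoly (0 : 'rV[rat]_(kS N r)) z = 0.
Proof. by rewrite /vpoly big1 // => i _; rewrite mxE mul0r. Qed.

Lemma inW0 N r : (2 <= r)%N -> inW (0 : 'rV[rat]_(kS N r)).
Proof. by move=> r2; apply/(inWP _ r2) => x y z _; rewrite !vpoly0 subrr. Qed.

Lemma inW_lin N r a (v v' : 'rV[rat]_(kS N r)) : (2 <= r)%N ->
  inW v -> inW v' -> inW (a *: v + v').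
Proof.
move=> r2 /(inWP _ r2) h /(inWP _ r2) h'; apply/(inWP _ r2) => x y z sz.
by rewrite !vpoly_lin h // h' //; ring.
Qed.

Lemma vpoly_prefix N r k M p z1 z2 (x : 'rV[rat]_(kS M k)) :
  p \in Sseq (N - M) (r - k) -> (M <= N)%N -> (k <= r)%N -> size z1 = size p ->
  vpoly (x *m prefix_mx N r k M p) (z1 ++ z2) = monom z1 (map predn p) * vpoly x z2.
Proof.
move=> hp MN kr sz; rewrite /vpoly; under eq_bigr => i _ do rewrite mxE mulr_suml.
rewrite exchange_big mulr_sumr; apply: eq_bigr => s _ /=.
under eq_bigr => i _ do rewrite mxE -mulrA mulrCA mulrC.
rewrite (sum_Sidx (fun e => x ord0 s * monom (z1 ++ z2) (map predn e)) (prefix_mem s hp MN kr)).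
by rewrite map_cat monom_cat ?size_map //; ring.
Qed.

Section WBasis.
Variables (N r : nat).
Hypothesis r2 : (2 <= r)%N.
Variables (d : 'I_N.+1 -> nat) (X : forall n : 'I_N.+1, 'M[rat]_(d n, kS n 2))
  (Y : forall n : 'I_N.+1, 'M[rat]_(kS n 2, d n)).
Hypothesis XY : forall n, X n *m Y n = 1%:M.
Hypothesis XW : forall (n : 'I_N.+1) (v : 'rV_(kS n 2)), inW v <-> (v <= X n)%MS.

(** The polynomial factors, and the defining equation concerns only the factor in the first two
    variables. *)
Lemma inW_tens (t : {n : 'I_N.+1 & 'I_(d n)}) (x : 'rV_(kS (N - tag t) (r - 2))) : inW (x *m tens r X t).
Proof.
have E a b z : vpoly (x *m tens r X t) [:: a, b & z] =
    vpoly (row (tagged t) (X (tag t))) [:: a; b] * vpoly x z.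
  rewrite /tens mulmx_sumr.
  have -> : vpoly (\sum_q x *m (X (tag t) (tagged t) q *:
        prefix_mx N r (r - 2) (N - tag t) (Sidx q))) [:: a, b & z] =
      \sum_q X (tag t) (tagged t) q *
        vpoly (x *m prefix_mx N r (r - 2) (N - tag t) (Sidx q)) [:: a, b & z].
    elim/big_rec2: _ => [|q s1 s2 _ <-]; first by rewrite vpoly0.
    by rewrite -scalemxAr vpoly_lin.
  rewrite {2}/vpoly mulr_suml; apply: eq_bigr => q _.
  rewrite -[[:: a, b & z]]/([:: a; b] ++ z) vpoly_prefix ?leq_subr ?Sidx_size // ?mxE ?mulrA //.
  by rewrite subKn ?leq_ord // subKn //; apply: Sidx_mem.
apply/(inWP _ r2) => a b z _; rewrite !E -mulrBl; congr (_ * _).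
have : inW (row (tagged t) (X (tag t))) by apply/XW; apply: row_sub.
by move/(@inWP _ 2 _ isT)/(_ a b [::] erefl).
Qed.

(** For fixed a and b, the defect of the defining equation is a polynomial in the remaining
    variables whose coefficients are the defects of the slices. It vanishes identically, so each
    coefficient does. *)
Lemma inW_slice (v : 'rV[rat]_(kS N r)) (n : 'I_N.+1) (s : 'I_(kS (N - n) (r - 2))) :
  inW v -> inW (slice v s).
Proof.
move=> /(inWP _ r2) hv; apply/(@inWP _ 2 _ isT) => a b [|? ?] // _.
pose M a b (i : 'I_(kS N r)) := monom [:: a; b] (map predn (take 2 (Sidx i))).
pose c i := M a b i - M (b - a) b i + M (b - a) a i.
pose P : mpoly := [seq (map predn (drop 2 (Sidx i)), v ord0 i * c i) | i <- enum 'I_(kS N r)].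
have hM a' b' z i : monom [:: a', b' & z] (map predn (Sidx i)) =
    M a' b' i * monom z (map predn (drop 2 (Sidx i))).
  rewrite -[[:: a', b' & z]]/([:: a'; b'] ++ z) -{1}(cat_take_drop 2 (Sidx i)) map_cat monom_cat //.
  by rewrite size_map size_takel // Sidx_size.
have P0 : mcoef P (map predn (Sidx s)) = 0.
  apply: (@mcoef_vanish (r - 2)).
    by apply/allP => t /mapP[i _ ->] /=; rewrite size_map size_drop Sidx_size.
  move=> z sz; rewrite /meval big_map big_enum /=.
  have szr : (size z).+2 = r by rewrite sz; lia.
  have /eqP := hv a b z szr; rewrite -subr_eq0 => /eqP h; rewrite -[RHS]h.
  rewrite /vpoly -!sumrB; apply: eq_bigr => i _; rewrite !hM /c; ring.
have S a' b' : vpoly (slice v s) [:: a'; b'] = \sum_(i | drop 2 (Sidx i) == Sidx s) v ord0 i * M a' b' i.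
  rewrite [RHS]big_mkcond /vpoly /=.
  under eq_bigr => q _ do rewrite !mxE mulr_suml.
  rewrite exchange_big; apply: eq_bigr => i _ /=.
  under eq_bigr => q _ do rewrite !mxE.
  have sz2 : size (take 2 (Sidx i)) = 2%N by rewrite size_takel // Sidx_size.
  have E (q : 'I_(kS n 2)) : (Sidx i == Sidx q ++ Sidx s) = (take 2 (Sidx i) == Sidx q) && (drop 2 (Sidx i) == Sidx s).
    by rewrite -{1}(cat_take_drop 2 (Sidx i)) eqseq_cat ?sz2 ?Sidx_size.
  under eq_bigr => q _ do rewrite E.
  case: eqP => [es|_]; last by rewrite big1 // => q _; rewrite andbF mulr0 mul0r.
  under eq_bigr => q _ do rewrite andbT (eq_sym _ (Sidx q)) mulrAC.
  rewrite (sum_Sidx (fun e => v ord0 i * monom [:: a'; b'] (map predn e))) //.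
  move: (Sidx_mem i); rewrite !mem_Sseq sz2 /= -{1 2 3}(cat_take_drop 2 (Sidx i)) es.
  rewrite sumn_cat all_cat Sidx_sumn => /and3P[_ /eqP sm /andP[-> _]]; rewrite andbT.
  by apply/eqP; have := ltn_ord n; lia.
apply/eqP; rewrite -subr_eq0; apply/eqP; rewrite -[RHS]P0 !S.
rewrite /mcoef big_map big_enum_cond -!sumrB /=; apply: eq_big => [i|i _]; last by rewrite /c; ring.
rewrite map_predn_inj ?Sidx_all //.
by have := Sidx_all i; rewrite -{1}(cat_take_drop 2 (Sidx i)) all_cat => /andP[].
Qed.

Lemma inW_sub_tens (v : 'rV[rat]_(kS N r)) :
  inW v <-> (v <= \sum_(t : {n : 'I_N.+1 & 'I_(d n)}) <<tens r X t>>)%MS.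
Proof.
split=> [hv|/sub_sumsmxP[u ->]].
  by apply: (sub_tens r2 XY) => n s; apply/XW; apply: inW_slice.
elim/big_rec: _ => [|t g _ hg]; first exact: inW0.
rewrite -[_ *m _]scale1r; apply: inW_lin => //.
have /submxP[x ->] : (u t *m <<tens r X t>>%MS <= tens r X t)%MS.
  by rewrite (submx_trans (submxMl _ _)) // genmxE.
exact: inW_tens.
Qed.

End WBasis.

(** * Generating series and the recursion *)

Lemma kS1 n : (kS n 1)%:R = OS n :> rat.
Proof.
have -> : kS n 1 = (odd n && (3 <= n)%N) :> nat.
  rewrite /kS -[RHS]/(nat_of_bool _); case: (boolP (odd n && (3 <= n)%N)) => h.
    apply/eqP; rewrite -[(true : nat)]/(size [:: [:: n]]); apply/eqP/perm_size/uniq_perm; rewrite ?Sseq_uniq //.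
    move=> s; rewrite mem_Sseq inE; case: s => [|a [|b s]] //=.
      rewrite addn0 andbT eqseq_cons eqxx andbT.
      by case: eqP => //= ->; rewrite h.
    by rewrite eqseq_cons andbF.
  apply/eqP; rewrite -leqn0 leqNgt; apply/negP => k0.
  have := Sidx_mem (Ordinal k0); rewrite mem_Sseq; case: (Sidx _) => [|a [|b s]] //=.
  by rewrite addn0 andbT => /andP[/eqP ->]; rewrite (negbTE h).
rewrite /OS /mulS; case: (ltnP n 3) => hn.
  rewrite andbF big1 // => i _; rewrite /serX (_ : (nat_of_ord i == 3%N) = false) ?mul0r //.
  by apply/eqP; have := ltn_ord i; lia.
have h : (3 < n.+1)%N by lia.
rewrite (bigD1 (Ordinal h)) //= /serX eqxx mul1r big1 ?addr0 => [|i hi].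
  by rewrite andbT /geomS dvdn2 oddB // addbT negbK.
rewrite (_ : (nat_of_ord i == 3%N) = false) ?mul0r //.
by apply: contraNF hi => /eqP e; apply/eqP/val_inj.
Qed.

(** The tensor decomposition with l = 1 and the full space in the first index. *)
Lemma rank_Eprod_first N r m : (0 < r)%N -> (m < r - 1)%N || (m == 0%N) ->
  \rank (Eprod N r m) = (\sum_(n < N.+1) kS n 1 * \rank (Eprod (N - n) (r - 1) m))%N.
Proof.
move=> r0 hm; have XY (n : 'I_N.+1) : (1%:M : 'M[rat]_(kS n 1)) *m 1%:M = 1%:M by rewrite mulmx1.
rewrite -(rank_tens_Eprod r0 XY) //.
rewrite (eqmxMfull (Eprod N r m)) // -sub1mx; apply/row_subP => i.
by apply: (sub_tens r0 XY) => n s; apply: submx1.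
Qed.

Lemma kS_rec N r : (0 < r)%N -> kS N r = (\sum_(n < N.+1) kS n 1 * kS (N - n) (r - 1))%N.
Proof.
move=> r0; have := @rank_Eprod_first N r 0 r0; rewrite orbT mxrank1 => -> //.
by apply: eq_bigr => n _; rewrite mxrank1.
Qed.

Lemma powS_OS k M : powS OS k M = (kS M k)%:R.
Proof.
elim: k M => [|k IH] M; first by rewrite /powS /= /serX /kS /=; case: eqP.
rewrite kS_rec // natr_sum /powS iterS -/(powS OS k) /mulS; apply: eq_bigr => n _.
by rewrite IH natrM kS1 subn1.
Qed.

Lemma rank_Eprod_cap_ker N r (d : 'I_N.+1 -> nat) (X : forall n : 'I_N.+1, 'M[rat]_(d n, kS n 2))
    (Y : forall n : 'I_N.+1, 'M[rat]_(kS n 2, d n)) :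
  hypH -> hypG -> (3 <= r)%N -> (forall n, X n *m Y n = 1%:M) ->
  (forall (n : 'I_N.+1) (v : 'rV_(kS n 2)), inW v <-> (v <= X n)%MS) ->
  \rank (Eprod N r (r - 2) :&: kermx (Emx N r))%MS
  = (\sum_(n < N.+1) d n * \rank (Cmx (N - n) (r - 2)))%N.
Proof.
move=> hH hG r3 XY XW; have r2 : (2 <= r)%N by lia.
have WP := inW_sub_tens r2 XY XW.
set W := (\sum_t _)%MS in WP.
have -> : \rank (Eprod N r (r - 2) :&: kermx (Emx N r))%MS = \rank (W *m Eprod N r (r - 2)).
  (* Both inclusions are (G), with phi^(r) read as multiplication by E_r and [phicomp] as
     multiplication by [Eprod N r (r - 2)]. *)
  apply/eqmx_rank/andP; split; apply/rV_subP => u.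
    rewrite sub_capmx => /andP[/submxP[v hv] /sub_kermxP hu].
    have [_ /(_ _)[]] := hG r N r3 u.
      split; first by rewrite phi_mulmx ?EmxE //; lia.
      by exists v; rewrite phicompE.
    move=> w /WP/submxP[x ->] <-; rewrite phicompE // -mulmxA; exact: submxMl.
  move=> /submxP[x hx].
  have [/(_ _)[]] := hG r N r3 u.
    exists (x *m W); first by apply/WP; apply: submxMl.
    by rewrite phicompE // hx mulmxA.
  rewrite phi_mulmx ?EmxE; last by lia.
  move=> hu [v hv] _; rewrite sub_capmx -hv phicompE // submxMl /=.
  by apply/sub_kermxP; rewrite -phicompE // hv.
have -> : (r - 2 = (r - 3).+1)%N by lia.
rewrite Eprod_rcons mulmxA.
(* E^(2), ..., E^(r-2) act only on the last r - 2 indices, hence preserve W. *)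
have WD : (W *m Eprod N r (r - 3) <= W)%MS.
  rewrite /W; rewrite (sumsmxMr xpredT); apply/sumsmx_subP => t _.
  apply: (sumsmx_sup t) => //; rewrite genmxE.
  have e : (<<tens r X t>>%MS *m Eprod N r (r - 3) <= tens r X t *m Eprod N r (r - 3))%MS.
    by apply: submxMr; rewrite genmxE.
  apply: (submx_trans e); rewrite tens_Eprod ?submxMl //; lia.
(* If v in W is killed by E^(r-1), then [inW_phi] gives v E_r = v, that is v F_r = 0, and (H) forces
   v = 0. *)
have K0 : \rank (W *m Eprod N r (r - 3) :&: kermx (Ejmx N r (r - 3).+2))%MS = 0%N.
  apply/eqP; rewrite mxrank_eq0; apply/rowV0P => v; rewrite sub_capmx => /andP[hv /sub_kermxP ker].
  have vW : inW v by apply/WP; apply: submx_trans hv WD.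
  apply: (hH N r r2) => //; first exact: inW0.
  rewrite mul0mx /Fmx mulmxBr mulmx1 -EmxE.
  have := inW_phi r3 vW; rewrite !phi_mulmx; try lia.
  have -> : (r.-1 = (r - 3).+2)%N by lia.
  by rewrite ker addr0 => ->; rewrite subrr.
have := mxrank_mul_ker (W *m Eprod N r (r - 3)) (Ejmx N r (r - 3).+2).
rewrite K0 addn0 => ->; rewrite (rank_tens_Eprod r2 XY); last by lia.
by apply: eq_bigr => n _; rewrite CmxE; congr (_ * \rank (Eprod _ _ _))%N; lia.
Qed.

Theorem theorem5p2 : hypH -> hypG -> forall r : nat, (3 <= r)%N ->
  forall N : nat,
    Tser r N = addS (subS (mulS OS (Tser (r - 1))) (mulS SS (Tser (r - 2))))
                    (mulS (powS OS (r - 2)) SS) N.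
Proof.
move=> hH hG r r3 N.
have exB (n : 'I_N.+1) : exists b : {d & 'M[rat]_(d, kS n 2)},
    [/\ row_free (tagged b), SS n = (tag b)%:R
       & forall v : 'rV_(kS n 2), inW v <-> (v <= tagged b)%MS].
  have [d [B hB]] := exists_W2_basis n.
  by exists (Tagged (fun d => 'M[rat]_(d, kS n 2)) B).
have [b hb] := fin_all_exists exB.
have exY (n : 'I_N.+1) : exists Y : 'M[rat]_(kS n 2, tag (b n)), tagged (b n) *m Y = 1%:M.
  by have [/row_freeP] := hb n.
have [Y hY] := fin_all_exists exY.
have hW (n : 'I_N.+1) : forall v : 'rV_(kS n 2), inW v <-> (v <= tagged (b n))%MS by have [] := hb n.
have key := rank_Eprod_cap_ker hH hG r3 hY hW.
have r0 : (0 < r)%N by lia.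
have rankB := @rank_Eprod_first N r (r - 2) r0; rewrite (_ : (r - 2 < r - 1)%N) in rankB; last by lia.
have {rankB} /(_ isT) rankB := rankB.
have CE : Cmx N r = Eprod N r (r - 2) *m Emx N r.
  rewrite CmxE (_ : (r - 1 = (r - 2).+1)%N); last by lia.
  by rewrite Eprod_rcons -EmxE; congr (_ *m Ejmx _ _ _); lia.
(* The rank lost in the last factor E_r is the dimension computed in [key]. *)
have rankC : (\rank (Cmx N r) + \rank (Eprod N r (r - 2) :&: kermx (Emx N r))%MS = \rank (Eprod N r (r - 2)))%N.
  by rewrite CE mxrank_mul_ker.
have SSE n : SS (nat_of_ord n) = (tag (b n))%:R by have [] := hb n.
rewrite TserE // /addS /subS.
have -> : mulS OS (Tser (r - 1)) N = (kS N r)%:R - (\rank (Eprod N r (r - 2)))%:R.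
  rewrite rankB (@kS_rec N r) // !natr_sum -sumrB; apply: eq_bigr => n _.
  rewrite TserE; last by lia.
  rewrite -kS1 mulrBr -!natrM CmxE; congr (_ - (_ * \rank (Eprod _ _ _))%N%:R); lia.
(* O^(r-2) counts the indices of length r - 2, so the last two terms of the recursion combine to the
   sum of dim W_{n,2} times rank C_{N-n,r-2}. *)
have -> : mulS (powS OS (r - 2)) SS N = \sum_(n < N.+1) SS n * (kS (N - n) (r - 2))%:R.
  rewrite /mulS (reindex_inj rev_ord_inj); apply: eq_bigr => n _ /=.
  by rewrite subSS subKn ?leq_ord // powS_OS mulrC.
have -> : mulS SS (Tser (r - 2)) N = \sum_(n < N.+1) SS n * (kS (N - n) (r - 2))%:R
   - (\rank (Eprod N r (r - 2) :&: kermx (Emx N r))%MS)%:R.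
  rewrite key natr_sum -sumrB; apply: eq_bigr => n _.
  by rewrite TserE ?mulrBr ?natrM ?SSE //; lia.
rewrite -rankC natrD; ring.
Qed.
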